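(* Let $d \ge 1$ and let $S \subset \mathbb{R}^d$ be an arbitrary simplex with vertices $v_1, \dots, v_{d+1}$. For any real $t > 0$, any $y \in \mathbb{R}^d$ and any $R > \max_j |\langle v_j, y \rangle|$, \[ \hat{\chi}_{tS}(y) = \frac{(-1)^d d!}{(2\pi i)^{d+1}} \lambda(S) \int_{|z| = R} \frac{e^{-2\pi i z t}}{(z - \langle v_1, y\rangle) \cdots (z - \langle v_{d+1}, y \rangle)}\, dz, \] where the integral is a complex line integral along the positively oriented circle of radius $R$ centered at the origin.
   Context: $\lambda$ denotes Lebesgue measure on $\mathbb{R}^d$, $tS = \{tx : x \in S\}$, $\chi_{tS}$ is the characteristic function of $tS$, and $\hat{\chi}_{tS}(y) = \int_{tS} e^{-2\pi i \langle x, y \rangle}\, dx$. *)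

(* Defs.v *)
From HB Require Import structures.
From mathcomp Require Import all_boot all_order all_algebra.
From mathcomp Require Import all_classical all_reals all_analysis.
From mathcomp Require Import complex.
Set Implicit Arguments. Unset Strict Implicit. Unset Printing Implicit Defensive.
Import Order.TTheory GRing.Theory Num.Theory.
Local Open Scope classical_set_scope.
Local Open Scope ring_scope.
Local Open Scope complex_scope.

Section Defs.
Variable R : realType.

Definition dotp (n : nat) (u w : 'rV[R]_n) : R := \sum_(i < n) u 0 i * w 0 i.

Definition simplex (d : nat) (v : 'I_d.+1 -> 'rV[R]_d) : set 'rV[R]_d :=
  [set x | exists l : 'I_d.+1 -> R,
      (forall j, 0 <= l j) /\ \sum_j l j = 1 /\ x = \sum_j l j *: v j].

Definition affinely_independent (d : nat) (v : 'I_d.+1 -> 'rV[R]_d) : Prop :=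
  (\matrix_(i < d) (v (lift ord0 i) - v ord0)) \in unitmx.

Definition dilate (n : nat) (t : R) (A : set 'rV[R]_n) : set 'rV[R]_n :=
  [set t *: x | x in A].

(* Lebesgue integral on R^n, given as the iterated one-dimensional Lebesgue
   integral (Fubini/Tonelli), coordinate by coordinate. *)
Fixpoint eintegral_rV (n : nat) : ('rV[R]_n -> \bar R) -> \bar R :=
  match n with
  | 0 => fun f => f 0
  | n'.+1 => fun f =>
      (\int[@lebesgue_measure R]_x
          eintegral_rV (fun w : 'rV[R]_n' => f (row_mx (const_mx x : 'rV[R]_1) w)))%E
  end.

Fixpoint Rintegral_rV (n : nat) : ('rV[R]_n -> R) -> R :=
  match n with
  | 0 => fun f => f 0
  | n'.+1 => fun f =>
      Rintegral (@lebesgue_measure R) setT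
        (fun x => Rintegral_rV (fun w : 'rV[R]_n' => f (row_mx (const_mx x : 'rV[R]_1) w)))
  end.

Definition lebesgue_rV (n : nat) (A : set 'rV[R]_n) : \bar R :=
  eintegral_rV (fun x => (\1_A x)%:E).

(* Fourier transform of the characteristic function of A at y:
   int_A e^{-2 pi i <x,y>} dx = int_A cos(2 pi <x,y>) dx - i int_A sin(2 pi <x,y>) dx. *)
Definition fourier_chi (n : nat) (A : set 'rV[R]_n) (y : 'rV[R]_n) : R[i] :=
  Complex (Rintegral_rV (fun x => \1_A x * cos (2 * pi * dotp x y)))
          (- Rintegral_rV (fun x => \1_A x * sin (2 * pi * dotp x y))).

Definition ci : R[i] := Complex 0 1.

Definition cexp (z : R[i]) : R[i] :=
  let: Complex a b := z in Complex (expR a * cos b) (expR a * sin b).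

Definition circle_integral (f : R[i] -> R[i]) (r : R) : R[i] :=
  let g := fun th : R =>
    f (r%:C * cexp (Complex 0 th)) * (ci * r%:C * cexp (Complex 0 th)) in
  Complex (Rintegral (@lebesgue_measure R) `[0, 2 * pi]%classic (fun th => let: Complex a _ := g th in a))
          (Rintegral (@lebesgue_measure R) `[0, 2 * pi]%classic (fun th => let: Complex _ b := g th in b)).

End Defs.

(* Main.v *)
Require Import Defs.
From HB Require Import structures.
From mathcomp Require Import all_boot all_order all_algebra all_fingroup.
From mathcomp Require Import all_classical all_reals all_analysis.
From mathcomp Require Import measurable_realfun complex ring lra.
Import Order.TTheory GRing.Theory Num.Theory.
Local Open Scope classical_set_scope.
Local Open Scope ring_scope.
Local Open Scope complex_scope.
Import numFieldNormedType.Exports.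

Set Implicit Arguments. Unset Strict Implicit. Unset Printing Implicit Defensive.

(** Up to an affine change of variables the transform is an integral over the
    corner simplex {w >= 0, sum w <= 1}. Peeling off the first coordinate turns
    that integral into an iterated convolution of exponentials exp(-c a_j x),
    c = 2 pi i t. The contour integrals G_l(s) of exp(-c z s) / prod_(a in l) (z - a)
    satisfy the same recursion up to the factor -1/c: integrate
    exp(-c a x) exp(-c z (s - x)) over x in [0, s], divide by the remaining
    factors and exchange the two integrals; what is left over is the integral of
    1 / prod (z - a), which vanishes as soon as there are two poles. *)

(** * Integration on the line and on R^n *)

Section RealLine.
Context {R : realType}.
Notation mu := (@lebesgue_measure R).

(** The poles [dotp (v j) y] may coincide, so a formula by residues or divided differences would
    call for a genericity argument. The recursion avoids one: it divides only by [z - a] with [z] on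
    the circle and [a] inside, never by a difference of two poles. Of contour integration it takes
    just primitives along the circle, the integral of 1/z and one decay estimate. The other obstacle
    is that the integral over R^n is an iterated one-dimensional integral. Linear maps do not
    respect its order, so the Jacobian formula has to be assembled from one-dimensional affine
    substitutions and exchanges of coordinates. As for the constants, |det M| is d! times the volume
    of the simplex, the t^d of the dilation cancels against (-1/c)^d, and the base case of the
    recursion supplies the last factor 1/(2 pi i). *)

Lemma measurable_affine (a b : R) :
  measurable_fun setT ((fun x => a * x + b) : measurableTypeR R -> measurableTypeR R).
Proof. by apply: measurable_funD => //; apply: measurable_funM. Qed.

(** Half-open intervals determine Lebesgue measure, so it suffices to compare lengths there. A
    negative [a] reverses the order, and the preimage of []u, v]] is then closed on the left. *)
Lemma lebesgue_measure_affine (a b : R) (A : set R) : a != 0 -> measurable A ->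
  pushforward (mscale (NngNum (normr_ge0 a)) mu)
    ((fun x => a * x + b) : R -> measurableTypeR R) A = mu A.
Proof.
move=> a0 mA; apply/esym/lebesgue_measure_unique => //=; first exact: measurable_affine.
move=> mf _ [[u v]] _ <-; rewrite /pushforward /mscale /=.
have [apos|aneg|] := ltrgt0P a; last by move=> a00; rewrite a00 eqxx in a0.
- have -> : (fun x => a * x + b) @^-1` `]u, v] = `](u - b) / a, (v - b) / a]%classic.
    apply/seteqP; split=> x /=; rewrite !in_itv/= ltr_pdivrMr// ler_pdivlMr//;
    by rewrite ltrBlDr lerBrDr (mulrC x).
  rewrite !lebesgue_measure_itv/= !lte_fin ltr_pM2r ?invr_gt0// ltrD2r.
  case: ifP => _; last by rewrite mule0.
  by rewrite -!EFinB -EFinM; congr (_%:E); field.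
- have -> : (fun x => a * x + b) @^-1` `]u, v] = `[(v - b) / a, (u - b) / a[%classic.
    apply/seteqP; split=> x /=; rewrite !in_itv/= ltr_ndivlMr// ler_ndivrMr//;
    by rewrite ltrBlDr lerBrDr (mulrC x) andbC.
  rewrite !lebesgue_measure_itv/= !lte_fin ltr_nM2r ?invr_lt0// ltrD2r.
  case: ifP => _; last by rewrite mule0.
  by rewrite -!EFinB -EFinM; congr (_%:E); field.
Qed.

Lemma lebesgue_segment_lty (a b : R) : (mu (`[a, b]%classic : set R) < +oo)%E.
Proof.
by rewrite lebesgue_measure_itv; case: ifP => //= _; rewrite -EFinB ltry.
Qed.

(* cbm: measurable, bounded, of bounded support. *)
Definition cbm (g : R -> R) := measurable_fun setT g /\
  exists M : R, forall x, `|g x| <= M /\ (g x != 0 -> `|x| <= M).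

Lemma cbm_integrable g : cbm g -> mu.-integrable setT (EFin \o g).
Proof.
move=> [mg [M hM]].
have -> : g = g \_ `[-M, M]%classic.
  apply/funext => x; rewrite patchE; case: ifPn => // /negP xM.
  apply/eqP/negPn/negP => /(proj2 (hM x)) xM'; apply: xM.
  by rewrite inE/= in_itv/= -ler_norml.
rewrite -restrict_EFin.
have mI : measurable (`[- M, M]%classic : set (measurableTypeR R)) by exact: measurable_itv.
apply: (@integrable_mkcond _ _ R mu _ (EFin \o g) mI).1. 
apply: (measurable_bounded_integrable mI).
- exact: lebesgue_segment_lty.
- exact: measurable_funTS.
- exists M; split; first exact: num_real.
  by move=> N MN x _ /=; apply: le_trans (ltW MN); have [] := hM x.
Qed.

Lemma Rintegral_affine (a b : R) (g : R -> R) : a != 0 -> cbm g ->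
  `|a| * \int[mu]_x g (a * x + b) = \int[mu]_x g x.
Proof.
move=> a0 cg; have ig := cbm_integrable cg; have [mg _] := cg.
(* First the nonnegative case, where the formula is integration against a pushforward; [g] is later
   split into its positive and negative parts. *)
have H (f : R -> \bar R) : measurable_fun setT f -> (forall x, 0 <= f x)%E ->
  (\int[mu]_x f x = `|a|%:E * \int[mu]_x f (a * x + b)%R)%E.
  move=> mf f0.
  have mfa : measurable_fun setT (fun x => f (a * x + b)).
    exact: (measurableT_comp mf (measurable_affine a b)).
  rewrite -(ge0_integral_mscale mu measurableT (NngNum (normr_ge0 a)))//=.
  have -> : (\int[mscale (NngNum (normr_ge0 a)) mu]_x f (a * x + b)%R =
      \int[pushforward (mscale (NngNum (normr_ge0 a)) mu)
         ((fun x => a * x + b)%R : R -> measurableTypeR R)]_x f x)%E.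
    have P := @ge0_integral_pushforward _ _ _ _ _ _ (measurable_affine a b)
      (mscale (NngNum (normr_ge0 a)) mu) setT f measurableT mf (fun y _ => f0 y).
    exact/esym/P.
  apply: eq_measure_integral => [|mp A mA _]; first exact: measurable_affine.
  exact/esym/lebesgue_measure_affine.
have mEg : measurable_fun setT (EFin \o g) by exact/measurable_EFinP.
have iga : mu.-integrable setT (EFin \o (fun x => g (a * x + b))).
  apply/integrableP; split.
    apply/measurable_EFinP; exact: (measurableT_comp mg (measurable_affine a b)).
  have /integrableP[_] := ig; rewrite (H (fun x => `|(g x)%:E|%E))//; last first.
    exact: measurableT_comp.
  (* If [J] were infinite, so would be its product with the positive number |a|, which is the finite
     integral of |g|. *)
  set J := (\int[mu]_x _)%E => Jlt; rewrite -/J.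
  rewrite ltey; apply: contraTneq Jlt => /= ->.
  by rewrite gt0_muley ?ltxx// lte_fin normr_gt0.
rewrite /Rintegral -[X in X * _]/(fine `|a|%:E) -fineM//; last first.
  exact: (integrable_fin_num measurableT iga).
congr fine; rewrite [in LHS]integralE [in RHS]integralE.
rewrite (H _ (measurable_funepos mEg))// (H _ (measurable_funeneg mEg))//.
rewrite muleBr//.
  by congr (_ * _ - _ * _)%E; apply: eq_integral => x _; rewrite /= ?funeposE ?funenegE.
apply: fin_num_adde_defl; rewrite ?fin_numN.
exact: (integrable_neg_fin_num measurableT iga).
Qed.
End RealLine.

(** * Parameter integrals and Fubini for bounded functions of bounded support *)

Section Fubini.
Context {R : realType}.
Notation mu := (@lebesgue_measure R).

(** Tonelli makes the integrals of the positive and negative parts measurable in [t]; subtraction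
    and [fine] are measurable on the extended reals, so infinite values do no harm. *)
Lemma measurable_Rintegral d (T : measurableType d) (G : T * R -> R) :
  measurable_fun setT G -> measurable_fun setT (fun t => \int[mu]_x G (t, x)).
Proof.
move=> mG.
have mEG : measurable_fun setT (EFin \o G : T * measurableTypeR R -> \bar R).
  exact/measurable_EFinP.
apply: measurableT_comp => //.
under eq_fun do rewrite integralE.
apply: emeasurable_funB.
- rewrite (_ : (fun _ => _) = fubini_F mu ((EFin \o G)^\+)%E).
    exact: measurable_fun_fubini_tonelli_F (measurable_funepos mEG) (fun=> funepos_ge0 _ _).
  by apply/funext => t; apply: eq_integral => x _; rewrite !funeposE.
- rewrite (_ : (fun _ => _) = fubini_F mu ((EFin \o G)^\-)%E).
    exact: measurable_fun_fubini_tonelli_F (measurable_funeneg mEG) (fun=> funeneg_ge0 _ _).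
  by apply/funext => t; apply: eq_integral => x _; rewrite !funenegE.
Qed.

(** [M] and [N] are kept apart for the sake of iteration: every integration multiplies the bound on
    values by [2 * N], while the bound on the support stays [N]. *)
Lemma Rintegral_cbm_bound (g : R -> R) (M N : R) : measurable_fun setT g ->
  (forall x, `|g x| <= M) -> (forall x, g x != 0 -> `|x| <= N) -> 0 <= N ->
  `|\int[mu]_x g x| <= M * (2 * N).
Proof.
move=> mg gM gN N0.
have cg : cbm g.
  split=> //; exists (Num.max M N) => x; split.
    by rewrite le_max gM.
  by move=> /gN xN; rewrite le_max xN orbT.
apply: (le_trans (le_normr_Rintegral measurableT (cbm_integrable cg))).
have -> : M * (2 * N) = \int[mu]_(x in `[- N, N]) M.
  rewrite Rintegral_cst// [X in fine X](_ : _ = (2 * N)%:E)//.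
  transitivity (mu (`[- N, N]%classic : set R)) => //.
  rewrite lebesgue_measure_itv/= lte_fin; case: ltrP => [_|NN]/=.
    by rewrite -EFinB; congr EFin; lra.
  have -> : N = 0 by lra.
  by rewrite mulr0.
rewrite [leRHS]Rintegral_mkcond.
have cM : cbm ((fun=> M) \_ `[- N, N]).
  split; first by apply: (measurable_restrictT _ (measurable_itv _)).1; exact: measurable_cst.
  exists (Num.max `|M| N) => x; rewrite patchE; case: ifPn => xN.
    rewrite !le_max lexx; split=> // _.
    by move: xN; rewrite inE/= in_itv/= -ler_norml => ->; rewrite orbT.
  by rewrite normr0 eqxx le_max normr_ge0.
apply: le_Rintegral => //.
- have : cbm (fun x => `|g x|).
    split; first exact: measurableT_comp.
    by case: cg => _ [K hK]; exists K => x; rewrite normr_id normr_eq0.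
  exact: cbm_integrable.
- exact: (cbm_integrable cM).
- move=> x _; rewrite patchE; case: ifPn => [_|xN]; first exact: gM.
  rewrite normr_le0; apply/negPn/negP => /gN.
  by apply/negP; move: xN; rewrite notin_setE/= in_itv/= -ler_norml => /negP.
Qed.

Lemma Fubini_cbm (F : R * R -> R) (M : R) : measurable_fun setT F ->
  (forall z, `|F z| <= M) ->
  (forall z, F z != 0 -> `|z.1| <= M /\ `|z.2| <= M) ->
  \int[mu]_x \int[mu]_y F (x, y) = \int[mu]_y \int[mu]_x F (x, y).
Proof.
move=> mF FM sF.
pose A : set (measurableTypeR R) := `[- M, M]%classic.
have mA : measurable A by exact: measurable_itv.
have mAA : measurable (A `*` A) by exact: measurableX.
have iF : (mu \x mu)%E.-integrable setT (EFin \o F : measurableTypeR R * measurableTypeR R -> \bar R).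
  have -> : EFin \o F = (EFin \o F) \_ (A `*` A).
    apply/funext => z; rewrite patchE; case: ifPn => // zA.
    rewrite /=; congr EFin; apply/eqP/negPn/negP => /sF zM.
    by move/negP: zA; apply; rewrite inE /A/= !in_itv/= -!ler_norml; exact: zM.
  apply: (@integrable_mkcond _ _ R (mu \x mu)%E _ _ mAA).1.
  apply: (measurable_bounded_integrable mAA).
  - rewrite [X in (X < _)%E](_ : _ = mu A * mu A)%E; last exact: product_measure1E.
    apply: lte_mul_pinfty; first exact: measure_ge0; last exact: lebesgue_segment_lty.
    by rewrite ge0_fin_numE; [exact: lebesgue_segment_lty|exact: measure_ge0].
  - exact: measurable_funTS.
  - exists M; split; first exact: num_real.
    by move=> N MN x _ /=; apply: le_trans (ltW MN).
have cb1 x : cbm (fun y => F (x, y)).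
  split; first exact: (measurableT_comp mF (measurable_pair1 x)).
  by exists M => y; split=> // /sF[].
have cb2 y : cbm (fun x => F (x, y)).
  split; first exact: (measurableT_comp mF (measurable_pair2 y)).
  by exists M => x; split=> // /sF[].
(* [Rintegral] applies [fine] at both levels; since the inner integrals are finite, the outer [fine]
   alone gives the same value. *)
have E1 : \int[mu]_x \int[mu]_y F (x, y) =
    fine (\int[mu]_x \int[mu]_y (F (x, y))%:E)%E.
  congr fine; apply: eq_integral => x _; rewrite fineK//.
  exact: (integrable_fin_num measurableT (cbm_integrable (cb1 x))).
have E2 : \int[mu]_y \int[mu]_x F (x, y) =
    fine (\int[mu]_y \int[mu]_x (F (x, y))%:E)%E.
  congr fine; apply: eq_integral => y _; rewrite fineK//.
  exact: (integrable_fin_num measurableT (cbm_integrable (cb2 y))).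
by rewrite E1 E2; congr fine; exact: (Fubini iF).
Qed.

End Fubini.

(** * Iterated integrals of functions on row vectors *)

Section IteratedIntegral.
Context {R : realType}.
Notation mu := (@lebesgue_measure R).

(* Measurability on R^n without a sigma-algebra on row vectors: composing with
   any measurable family of coordinates gives a measurable function. *)
Definition rvmeas n (f : 'rV[R]_n -> R) := forall d (T : measurableType d) (h : T -> 'rV[R]_n),
  (forall i, measurable_fun setT (fun x => h x 0 i)) -> measurable_fun setT (f \o h).

Definition rv_bounded_by n (f : 'rV[R]_n -> R) (M N : R) :=
  forall x, `|f x| <= M /\ (f x != 0 -> forall i, `|x 0 i| <= N).

Definition rv_cbm n (f : 'rV[R]_n -> R) :=
  rvmeas f /\ exists M N, [/\ 0 <= M, 0 <= N & rv_bounded_by f M N].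

(** This has exactly the shape occurring in [Rintegral_rV], so that unfolding one level of the
    integral produces it up to conversion. *)
Definition rv_cons n (x : R) (w : 'rV[R]_n) : 'rV[R]_n.+1 :=
  row_mx (const_mx x : 'rV_1) w.

Lemma rv_cons0 n x (w : 'rV_n) (i : 'I_n.+1) : i = 0 :> nat -> rv_cons x w 0 i = x.
Proof.
move=> i0; rewrite /rv_cons (_ : i = lshift n (0 : 'I_1)); last exact: val_inj.
by apply: (etrans (row_mxEl _ _ _ _)); rewrite mxE.
Qed.

Lemma rv_consS n x (w : 'rV_n) (i : 'I_n) : rv_cons x w 0 (lift ord0 i) = w 0 i.
Proof.
rewrite /rv_cons (_ : lift ord0 i = rshift 1 i); last exact: val_inj.
exact: (row_mxEr (const_mx x : 'rV_1) w 0 i).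
Qed.

Lemma measurable_rv_cons n d (T : measurableType d) (g : T -> R) (h : T -> 'rV_n) :
  measurable_fun setT g -> (forall i, measurable_fun setT (fun x => h x 0 i)) ->
  forall i, measurable_fun setT (fun x => rv_cons (g x) (h x) 0 i).
Proof.
move=> mg mh i; case: (unliftP ord0 i) => [j|] ->.
  by under eq_fun do rewrite rv_consS; exact: mh.
by under eq_fun do rewrite rv_cons0//.
Qed.

(** Induction on [n] with the parameter space generalised: the coordinate of the outermost integral
    joins the parameter, so [T] becomes [T * R] in the induction hypothesis. *)
Lemma measurable_Rintegral_rV n d (T : measurableType d) (F : T -> 'rV[R]_n -> R) :
  (forall d' (T' : measurableType d') (g : T' -> T) (h : T' -> 'rV[R]_n),
    measurable_fun setT g -> (forall i, measurable_fun setT (fun x => h x 0 i)) ->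
    measurable_fun setT (fun x => F (g x) (h x))) ->
  measurable_fun setT (fun t => Rintegral_rV (F t)).
Proof.
elim: n d T F => [|n IHn] d T F mF /=.
  by apply: (mF _ _ id (fun=> 0)) => // i; case: i.
apply: (measurable_Rintegral (G := fun z => Rintegral_rV (fun w => F z.1 (rv_cons z.2 w)))).
apply: (IHn _ (T * R)%type (fun z w => F z.1 (rv_cons z.2 w))) => d' T' g h mg mh.
apply: (mF _ _ (fun x => (g x).1) (fun x => rv_cons (g x).2 (h x))).
  exact: (measurableT_comp measurable_fst mg).
apply: measurable_rv_cons => //.
exact: (measurableT_comp measurable_snd mg).
Qed.

Lemma rvmeas_slice n (f : 'rV[R]_n.+1 -> R) x : rvmeas f -> rvmeas (fun w => f (rv_cons x w)).
Proof.
move=> mf d T h mh; apply: (mf _ _ (fun t => rv_cons x (h t))).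
exact: measurable_rv_cons.
Qed.

Lemma measurable_slice n (f : 'rV[R]_n.+1 -> R) : rvmeas f ->
  measurable_fun setT (fun x => Rintegral_rV (fun w => f (rv_cons x w))).
Proof.
move=> mf; apply: (measurable_Rintegral_rV (T := R)) => d' T' g h mg mh.
apply: (mf _ _ (fun t => rv_cons (g t) (h t))).
exact: measurable_rv_cons.
Qed.

Lemma Rintegral_rV_bound n (f : 'rV[R]_n -> R) M N :
  rvmeas f -> 0 <= M -> 0 <= N -> rv_bounded_by f M N ->
  `|Rintegral_rV f| <= M * (2 * N) ^+ n.
Proof.
elim: n f M => [|n IHn] f M mf M0 N0 fMN.
  by rewrite expr0 mulr1; have [] := fMN 0.
rewrite exprSr mulrA; apply: Rintegral_cbm_bound => //.
- exact: measurable_slice.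
- move=> x; apply: IHn => //; first exact: rvmeas_slice.
  move=> w; have [fM fN] := fMN (rv_cons x w); split=> // /fN + i => /(_ (lift ord0 i)).
  by rewrite rv_consS.
- move=> x; apply: contraNT; rewrite -ltNge => xN.
  (* For [x] beyond [N] the slice is identically 0; the induction hypothesis with value bound 0 then
     makes its integral vanish. *)
  rewrite -normr_le0 -[leRHS](mul0r ((2 * N) ^+ n)).
  apply: IHn => //; first exact: rvmeas_slice.
  move=> w; suff -> : f (rv_cons x w) = 0 by rewrite normr0 eqxx.
  apply/eqP/negPn/negP => /(proj2 (fMN _))/(_ ord0).
  by rewrite rv_cons0// leNgt xN.
Qed.

Lemma rv_cbm_slice n (f : 'rV[R]_n.+1 -> R) x : rv_cbm f -> rv_cbm (fun w => f (rv_cons x w)).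
Proof.
move=> [mf [M [N [M0 N0 fMN]]]]; split; first exact: rvmeas_slice.
exists M, N; split=> // w; have [fM fN] := fMN (rv_cons x w).
by split=> // /fN + i => /(_ (lift ord0 i)); rewrite rv_consS.
Qed.

Lemma cbm_slice_integral n (f : 'rV[R]_n.+1 -> R) : rv_cbm f ->
  cbm (fun x => Rintegral_rV (fun w => f (rv_cons x w))).
Proof.
move=> [mf [M [N [M0 N0 fMN]]]]; split; first exact: measurable_slice.
have fMN' x : rv_bounded_by (fun w => f (rv_cons x w)) M N.
  move=> w; have [fM fN] := fMN (rv_cons x w); split=> // /fN + i => /(_ (lift ord0 i)).
  by rewrite rv_consS.
exists (Num.max (M * (2 * N) ^+ n) N) => x; split.
  by rewrite le_max Rintegral_rV_bound//; exact: rvmeas_slice.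
rewrite le_max orbC; apply: contraNT; rewrite negb_or -!ltNge => /andP[xN _].
rewrite -normr_le0 -[leRHS](mul0r ((2 * N) ^+ n)).
apply: Rintegral_rV_bound => //; first exact: rvmeas_slice.
move=> w; suff -> : f (rv_cons x w) = 0 by rewrite normr0 eqxx.
apply/eqP/negPn/negP => /(proj2 (fMN _))/(_ ord0).
by rewrite rv_cons0// leNgt xN.
Qed.

(** Bridges the extended-valued integral that defines the volume and the real-valued one in which
    all computations are made. *)
Lemma eintegral_rV_cbm n (f : 'rV[R]_n -> R) : rv_cbm f ->
  eintegral_rV (fun x => (f x)%:E) = (Rintegral_rV f)%:E.
Proof.
elim: n f => // n IHn f gf /=.
rewrite /Rintegral fineK; last first.
  exact: (integrable_fin_num measurableT (cbm_integrable (cbm_slice_integral gf))).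
by apply: eq_integral => x _; exact: (IHn _ (rv_cbm_slice x gf)).
Qed.

End IteratedIntegral.

(** * Affine changes of variables in the iterated integral *)

Section ChangeOfVariables.
Context {R : realType}.
Notation mu := (@lebesgue_measure R).

Lemma rv_cbm_affine n (f : 'rV[R]_n -> R) (A : 'M[R]_n) (b : 'rV_n) :
  A \in unitmx -> rv_cbm f -> rv_cbm (fun x => f (x *m A + b)).
Proof.
move=> uA [mf [M [N [M0 N0 fMN]]]]; split.
  move=> d T h mh; apply: (mf _ _ (fun t => h t *m A + b)) => i.
  under eq_fun do rewrite !mxE.
  apply: measurable_funD => //; apply: measurable_sum => j.
  by apply: measurable_funM => //; exact: mh.
pose B := invmx A.
(* The support bound comes from [x = (x *m A + b - b) *m B]; the outer sum over [i] makes it valid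
   for all coordinates at once. *)
exists M, (\sum_(i < n) \sum_(j < n) (N + `|b 0 j|) * `|B j i|).
have S0 i : 0 <= \sum_(j < n) (N + `|b 0 j|) * `|B j i|.
  by apply: sumr_ge0 => j _; rewrite mulr_ge0// addr_ge0.
split=> //; first exact: sumr_ge0.
move=> x; have [fM fN] := fMN (x *m A + b); split=> // /fN {}fN i.
rewrite (bigD1 i)//= -[leLHS]addr0; apply: lerD; last exact: sumr_ge0.
have -> : x = (x *m A + b - b) *m B by rewrite addrK mulmxK.
rewrite mxE; apply: (le_trans (ler_norm_sum _ _ _)); apply: ler_sum => j _.
rewrite normrM ler_wpM2r//.
rewrite [X in `|X|]mxE; apply: (le_trans (ler_normD _ _)); apply: lerD => //.
by rewrite [X in `|X|]mxE normrN.
Qed.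

(** The shift [b] is part of the property because a block triangular matrix makes the first
    coordinate act on the others as a shift. *)
Definition change_of_variables n (A : 'M[R]_n) := forall (f : 'rV[R]_n -> R) b, rv_cbm f ->
  `|\det A| * Rintegral_rV (fun x => f (x *m A + b)) = Rintegral_rV f.

(** Substituting through [B] in the integral of [f (x *m A + b)] turns [A] into [B *m A] and the
    factor |det A| into |det (B A)|. This allows reducing [A] by multiplications on the left. *)
Lemma change_of_variables_cancel n (A B : 'M[R]_n) : A \in unitmx -> B \in unitmx ->
  change_of_variables B -> change_of_variables (B *m A) -> change_of_variables A.
Proof.
move=> uA uB cB cBA f b gf.
rewrite -(cB _ 0 (rv_cbm_affine b uA gf)) mulrA -normrM [\det A * _]mulrC.
rewrite -det_mulmx -(cBA f b gf); congr (_ * Rintegral_rV _).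
by apply/funext => x; rewrite addr0 mulmxA.
Qed.

(** The row (x, w) is sent to (x a, x u + w D): for fixed [x] the inner integral is a substitution
    by [D] with a shift depending on [x], and what remains in [x] is one-dimensional and affine. *)
Lemma change_of_variables_block n (a : 'M[R]_1) (u : 'rV[R]_n) (D : 'M[R]_n) :
  change_of_variables D -> block_mx a u 0 D \in unitmx ->
  change_of_variables (block_mx a u 0 D : 'M[R]_n.+1).
Proof.
move=> cD; rewrite unitmxE det_ublock unitrM => /andP[ua uD] f b gf.
have -> : \det (block_mx a u 0 D : 'M[R]_n.+1) = \det a * \det D by exact (det_ublock a u D).
rewrite normrM.
have a00 : a = (a 0 0)%:M by exact: mx11_scalar.
have a0 : a 0 0 != 0.
  by move: ua; rewrite {1}a00 det_scalar expr1 unitfE.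
pose G x := Rintegral_rV (fun w => f (rv_cons x w)).
have cG : cbm G := cbm_slice_integral gf.
rewrite /= -[RHS](Rintegral_affine (b 0 0) a0 cG).
have D0 : `|\det D| != 0 by rewrite normr_eq0 -unitfE.
rewrite {1}a00 det_scalar expr1 -mulrA; congr (_ * _).
have bE : b = row_mx (lsubmx (b : 'rV_(1 + n))) (rsubmx (b : 'rV_(1 + n))).
  by rewrite hsubmxK.
have E (x : R) : Rintegral_rV (fun w : 'rV_n => f
   (row_mx (const_mx x) w *m block_mx a u 0 D + b)) = `|\det D|^-1 * G (a 0 0 * x + b 0 0).
  have := cD _ (const_mx x *m u + rsubmx (b : 'rV_(1 + n))) (rv_cbm_slice (a 0 0 * x + b 0 0) gf).
  rewrite -/(G _) => <-; rewrite mulKf//; congr Rintegral_rV; apply/funext => w.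
  congr f; rewrite mul_row_block mulmx0 addr0 [X in _ + X]bE add_row_mx.
  rewrite /rv_cons addrA (addrC (w *m D)).
  have -> : const_mx x *m a + lsubmx (b : 'rV_(1 + n)) = const_mx (a 0 0 * x + b 0 0) => //.
  apply/matrixP => i j; rewrite !ord1 !mxE big_ord1 !mxE mulrC.
  by congr (_ + b _ _); apply: val_inj.
rewrite (_ : Rintegral _ _ _ = \int[mu]_x (`|\det D|^-1 * G (a 0 0 * x + b 0 0))); last first.
  by apply: eq_Rintegral => x _; exact: E.
have iG : mu.-integrable setT (EFin \o (fun x => G (a 0 0 * x + b 0 0))).
  apply: cbm_integrable.
  case: cG => mG [K hK]; split.
    exact: (measurableT_comp mG (measurable_affine _ _)).
  exists (Num.max K (`|a 0 0|^-1 * (K + `|b 0 0|))) => x; have [h1 h2] := hK (a 0 0 * x + b 0 0).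
  rewrite !le_max h1; split=> // /h2 {}h2; apply/orP; right.
  rewrite mulrC ler_pdivlMr ?normr_gt0// -normrM mulrC.
  rewrite -[X in `|X|](addrK (b 0 0)); apply: (le_trans (ler_normB _ _)).
  by rewrite lerD2r.
by rewrite RintegralZl// mulVKf.
Qed.

(** For the identity matrix the content is invariance under translation. *)
Lemma change_of_variables1 n : change_of_variables (1%:M : 'M[R]_n).
Proof.
elim: n => [|n IHn].
  by move=> f b _; rewrite det1 normr1 mul1r /=; congr f; apply/rowP; case.
have E : (1%:M : 'M[R]_n.+1) = block_mx (1%:M : 'M[R]_1) 0 0 (1%:M : 'M[R]_n).
  exact: (scalar_mx_block 1 n (1 : R)).
by rewrite E; apply: change_of_variables_block => //; rewrite -E unitmx1.
Qed.

Lemma Rintegral_rV_translate n (f : 'rV[R]_n -> R) b : rv_cbm f ->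
  Rintegral_rV (fun x => f (x + b)) = Rintegral_rV f.
Proof.
move=> gf; rewrite -(change_of_variables1 b gf) det1 normr1 mul1r.
by congr Rintegral_rV; apply/funext => x; rewrite mulmx1.
Qed.

Lemma rv_cons_swap m (x y : R) (w : 'rV[R]_m) :
  rv_cons x (rv_cons y w) *m tperm_mx ord0 (lift ord0 ord0) = rv_cons y (rv_cons x w).
Proof.
rewrite -xcolE; apply/rowP => i; rewrite mxE.
case: (unliftP ord0 i) => [j|] ->; last first.
  by rewrite tpermL rv_consS !rv_cons0.
rewrite rv_consS; case: (unliftP ord0 j) => [k|] ->; last by rewrite tpermR !rv_cons0.
by rewrite tpermD// !rv_consS.
Qed.

(** The shift is first absorbed into the function [g]; Fubini then exchanges the two outermost
    integrals of [F], the integral of [g] over the other [m] coordinates. *)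
Lemma change_of_variables_swap m :
  change_of_variables (tperm_mx ord0 (lift ord0 ord0) : 'M[R]_m.+2).
Proof.
move=> f b gf.
have -> : `|\det (tperm_mx ord0 (lift ord0 ord0) : 'M[R]_m.+2)| = 1.
  by rewrite det_perm odd_tperm /= normrX normrN1 expr1n.
rewrite mul1r -(Rintegral_rV_translate b gf).
have := rv_cbm_affine b (unitmx1 _ _) gf.
under eq_fun do rewrite mulmx1.
set g := (fun x => f (x + b)) => -[mg [M [N [M0 N0 gMN]]]].
pose F z := Rintegral_rV (fun w : 'rV_m => g (rv_cons z.2 (rv_cons z.1 w))).
have gF z : rvmeas (fun w : 'rV_m => g (rv_cons z.2 (rv_cons z.1 w))).
  exact/(@rvmeas_slice _ _ (fun w => g (rv_cons z.2 w)))/rvmeas_slice.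
have F0 z : ~~ ((`|z.1| <= N) && (`|z.2| <= N)) -> F z = 0.
  move=> zN; apply/eqP; rewrite -normr_le0 -[leRHS](mul0r ((2 * N) ^+ m)).
  apply: Rintegral_rV_bound => // w.
  suff -> : g (rv_cons z.2 (rv_cons z.1 w)) = 0 by rewrite normr0 eqxx.
  apply/eqP/negPn; apply: contra zN => /(proj2 (gMN _)) h.
  have := h (lift ord0 ord0); have := h ord0.
  by rewrite rv_consS !rv_cons0// => -> ->.
have mF : measurable_fun setT F.
  apply: (measurable_Rintegral_rV (T := (R * R)%type)
    (F := fun z w => g (rv_cons z.2 (rv_cons z.1 w)))) => d' T' p h mp mh.
  apply: (mg _ _ (fun t => rv_cons (p t).2 (rv_cons (p t).1 (h t)))).
  apply: measurable_rv_cons; first exact: (measurableT_comp measurable_snd mp).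
  apply: measurable_rv_cons => //; exact: (measurableT_comp measurable_fst mp).
transitivity (\int[mu]_x \int[mu]_y F (x, y)).
  apply: eq_Rintegral => x _; apply: eq_Rintegral => y _.
  by congr Rintegral_rV; apply/funext => w; rewrite -(rv_cons_swap x y w).
rewrite (@Fubini_cbm _ F (Num.max (M * (2 * N) ^+ m) N) mF)//.
- move=> z; rewrite le_max; apply/orP; left; apply: Rintegral_rV_bound => // w.
  have [gM gN] := gMN (rv_cons z.2 (rv_cons z.1 w)); split=> // /gN + i.
  by move/(_ (lift ord0 (lift ord0 i))); rewrite !rv_consS.
- move=> z Fz; rewrite !le_max.
  by have /andP[-> ->] := contra_neqT (F0 z) Fz; rewrite !orbT.
Qed.

(** In the rank factorisation of a nonzero column the right factor is an invertible scalar; dividing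
    by it and inverting the left factor leaves the first unit column. *)
Lemma pid_mx_col_unit n (c : 'M[R]_(n.+1, 1)) : c != 0 ->
  exists2 E, E \in unitmx & E *m c = pid_mx 1.
Proof.
move=> c0; have rc : \rank c = 1.
  by apply/eqP; rewrite eqn_leq rank_leq_col lt0n mxrank_eq0.
pose k := row_ebase c 0 0.
have kE : row_ebase c = k%:M by exact: mx11_scalar.
have k0 : k != 0 by have := row_ebase_unit c; rewrite kE unitmxE det_scalar1 unitfE.
exists (k^-1 *: invmx (col_ebase c)).
  by rewrite unitmxZ ?unitfE ?invr_eq0// unitmx_inv col_ebase_unit.
rewrite -{2}[c]mulmx_ebase rc -scalemxAl -!mulmxA mulKmx ?col_ebase_unit//.
by rewrite kE mul_mx_scalar scalerA mulVf// scale1r.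
Qed.

(** The first column of [B] is (0, 1, 0, ..., 0), and exchanging its two top entries moves the 1 to
    the corner. *)
Lemma dlsubmx_swap m (B : 'M[R]_(1 + m.+1)) : ulsubmx B = 0 -> dlsubmx B = pid_mx 1 ->
  dlsubmx ((tperm_mx ord0 (lift ord0 ord0) : 'M[R]_m.+2) *m B : 'M[R]_(1 + m.+1)) = 0.
Proof.
move=> Bu Bd.
have Beq (i i' j j' : 'I_(1 + m.+1)) : i = i' -> j = j' -> B i j = B i' j' by move=> -> ->.
rewrite -xrowE; apply/matrixP => i j; rewrite [j]ord1 !mxE; case: (unliftP ord0 i) => [k|] ->.
  have -> : rshift 1 (lift ord0 k) = lift ord0 (lift ord0 k) :> 'I_m.+2 by exact: val_inj.
  rewrite tpermD//.
  transitivity (dlsubmx B (lift ord0 k) 0); last by rewrite Bd !mxE.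
  by rewrite !mxE; apply: Beq; apply: val_inj.
have -> : rshift 1 (ord0 : 'I_m.+1) = lift ord0 ord0 :> 'I_m.+2 by exact: val_inj.
rewrite tpermR; transitivity (ulsubmx B 0 0); last by rewrite Bu mxE.
by rewrite !mxE; apply: Beq; apply: val_inj.
Qed.

(* GL_(n+1) is Q U Q S Q, with S the swap of the first two coordinates and Q the
   block upper triangular matrices; Q is handled by induction on n, S by Fubini. *)
Theorem change_of_variables_unitmx n (A : 'M[R]_n) : A \in unitmx -> change_of_variables A.
Proof.
elim: n A => [|n IHn] A uA.
  have -> : A = 1%:M by apply/matrixP => -[].
  exact: change_of_variables1.
have block (B : 'M[R]_(1 + n)) : B \in unitmx -> dlsubmx B = 0 ->
    change_of_variables (B : 'M[R]_n.+1).
  move=> uB B0; have BE : B = block_mx (ulsubmx B) (ursubmx B) 0 (drsubmx B).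
    by rewrite -B0 submxK.
  move: uB; rewrite BE => uB; apply: change_of_variables_block => //.
  by apply: IHn; move: uB; rewrite !unitmxE det_ublock unitrM => /andP[].
pose c := dlsubmx (A : 'M[R]_(1 + n)).
have [c0|c0] := eqVneq c 0; first exact: block.
case: n IHn A uA block @c c0 => [|m] IHn A uA block c c0.
  by rewrite [c]flatmx0 eqxx in c0.
have [E uE Ec] := pid_mx_col_unit c0.
pose a := ulsubmx (A : 'M[R]_(1 + m.+1)).
(* Since [E *m c] is the first unit column, the upper right block of [Q] subtracts exactly [a] from
   the top entry, and [Q *m A] has first column (0, 1, 0, ..., 0). *)
pose Q : 'M[R]_(1 + m.+1) := block_mx 1%:M (- (a *m pid_mx 1 *m E)) 0 E.
have uQ : Q \in unitmx by rewrite unitmxE det_ublock det1 mul1r -unitmxE.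
pose S : 'M[R]_m.+2 := tperm_mx ord0 (lift ord0 ord0).
have uS : S \in unitmx by exact: unitmx_perm.
apply: (change_of_variables_cancel uA uQ).
  by apply: block => //; rewrite block_mxKdl.
apply: (change_of_variables_cancel _ uS) => //; first by rewrite unitmx_mul uQ.
  exact: change_of_variables_swap.
apply: block; first by rewrite !unitmx_mul uS uQ.
pose B : 'M[R]_(1 + m.+1) := Q *m A.
have BE : B = block_mx 1%:M (- (a *m pid_mx 1 *m E)) 0 E *m
    block_mx a (ursubmx (A : 'M[R]_(1 + m.+1))) c (drsubmx (A : 'M[R]_(1 + m.+1))).
  by rewrite /B submxK.
have Bu : ulsubmx B = 0.
  rewrite BE mulmx_block block_mxKul mul1mx mulNmx -!mulmxA Ec.
  by rewrite pid_mx_id// pid_mx_1 mulmx1 subrr.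
have Bd : dlsubmx B = pid_mx 1 by rewrite BE mulmx_block block_mxKdl mul0mx add0r Ec.
exact: dlsubmx_swap.
Qed.

End ChangeOfVariables.

(** * Complex-valued integrals *)

Section ComplexToolkit.
Context {R : realType}.
Notation mu := (@lebesgue_measure R).
Notation re := (@complex.Re R).
Notation im := (@complex.Im R).
Notation normc := (@Normc.normc R).
Implicit Types z w : R[i].

Lemma reM z w : re (z * w) = re z * re w - im z * im w.
Proof. by case: z w => [a b] [c d]. Qed.

Lemma imM z w : im (z * w) = re z * im w + im z * re w.
Proof. by case: z w => [a b] [c d]. Qed.

Lemma reD z w : re (z + w) = re z + re w.
Proof. by case: z w => [a b] [c d]. Qed.

Lemma imD z w : im (z + w) = im z + im w.
Proof. by case: z w => [a b] [c d]. Qed.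

Lemma complexP z w : re z = re w -> im z = im w -> z = w.
Proof. by case: z w => [a b] [c d] /= -> ->. Qed.

Lemma re_le_normc z : `|re z| <= normc z.
Proof. by case: z => a b; rewrite /= -sqrtr_sqr ler_wsqrtr// lerDl sqr_ge0. Qed.

Lemma im_le_normc z : `|im z| <= normc z.
Proof. by case: z => a b; rewrite /= -sqrtr_sqr ler_wsqrtr// lerDr sqr_ge0. Qed.

Lemma normc_ge0 z : 0 <= normc z.
Proof. by case: z => a b; exact: sqrtr_ge0. Qed.

Lemma normc_le z : normc z <= `|re z| + `|im z|.
Proof.
case: z => a b /=; rewrite -[leRHS]ger0_norm ?addr_ge0// -sqrtr_sqr ler_wsqrtr//.
rewrite sqrrD !real_normK ?num_real// -addrA lerD2l lerDr.
by rewrite mulrn_wge0// mulr_ge0.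
Qed.

Lemma normc_real (x : R) : normc x%:C = `|x|.
Proof. by rewrite /= expr0n/= addr0 sqrtr_sqr. Qed.

Lemma normc_gt0 z : z != 0 -> 0 < normc z.
Proof.
move=> z0; rewrite lt_neqAle normc_ge0 andbT eq_sym.
by apply: contra z0 => /eqP/Normc.eq0_normc ->.
Qed.

Lemma normcX z n : normc (z ^+ n) = normc z ^+ n.
Proof.
by elim: n => [|n IHn]; rewrite ?expr0 ?Normc.normc1// !exprS Normc.normcM IHn.
Qed.

Lemma cexpD z w : cexp (z + w) = cexp z * cexp w.
Proof.
case: z w => [a b] [c d]; apply: complexP; rewrite ?reM ?imM /= expRD ?cosD ?sinD; ring.
Qed.

Lemma cexp0 : cexp 0 = 1 :> R[i].
Proof. by apply: complexP => /=; rewrite expR0 ?cos0 ?sin0 ?mulr1 ?mulr0. Qed.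

Lemma normc_cexp z : normc (cexp z) = expR (re z).
Proof.
case: z => a b /=; rewrite !exprMn -mulrDr cos2Dsin2 mulr1 sqrtr_sqr.
by rewrite ger0_norm// expR_ge0.
Qed.

Lemma cexp_neq0 z : cexp z != 0.
Proof.
apply/eqP => /(congr1 normc); rewrite normc_cexp Normc.normc0 => /eqP.
by rewrite gt_eqF// expR_gt0.
Qed.

Definition cmeas d (T : measurableType d) (f : T -> R[i]) :=
  measurable_fun setT (fun x => re (f x)) /\ measurable_fun setT (fun x => im (f x)).

Section cmeas.
Context d (T : measurableType d).
Implicit Types f g : T -> R[i].

Lemma cmeas_cst z : cmeas (fun _ : T => z).
Proof. by split; exact: measurable_cst. Qed.

Lemma cmeas_real (h : T -> R) : measurable_fun setT h -> cmeas (fun x => (h x)%:C).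
Proof. by move=> mh; split=> //=; exact: measurable_cst. Qed.

Lemma cmeasD f g : cmeas f -> cmeas g -> cmeas (fun x => f x + g x).
Proof.
move=> [f1 f2] [g1 g2]; split.
  by under eq_fun do rewrite reD; exact: measurable_funD.
by under eq_fun do rewrite imD; exact: measurable_funD.
Qed.

Lemma cmeasM f g : cmeas f -> cmeas g -> cmeas (fun x => f x * g x).
Proof.
move=> [f1 f2] [g1 g2]; split.
  by under eq_fun do rewrite reM; apply: measurable_funB; exact: measurable_funM.
by under eq_fun do rewrite imM; apply: measurable_funD; exact: measurable_funM.
Qed.

Lemma cmeas_cexp f : cmeas f -> cmeas (fun x => cexp (f x)).
Proof.
move=> [f1 f2]; split.
- rewrite (_ : (fun _ => _) = fun x => expR (re (f x)) * cos (im (f x))).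
    apply: measurable_funM; first exact: (measurableT_comp (@measurable_expR R) f1).
    apply: (measurableT_comp _ f2); apply: continuous_measurable_fun.
    exact: continuous_cos.
  by apply/funext => x; case: (f x).
- rewrite (_ : (fun _ => _) = fun x => expR (re (f x)) * sin (im (f x))).
    apply: measurable_funM; first exact: (measurableT_comp (@measurable_expR R) f1).
    apply: (measurableT_comp _ f2); apply: continuous_measurable_fun.
    exact: continuous_sin.
  by apply/funext => x; case: (f x).
Qed.

(* The hypothesis on h makes h / |f|^2 = h exp(- ln |f|^2) hold where f vanishes too. *)
Lemma measurable_div_norm2 f (h : T -> R) : cmeas f -> measurable_fun setT h ->
  (forall x, f x = 0 -> h x = 0) ->
  measurable_fun setT (fun x => h x / (re (f x) ^+ 2 + im (f x) ^+ 2)).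
Proof.
move=> [f1 f2] mh h0.
rewrite (_ : (fun _ => _) = fun x => h x * expR (- ln (re (f x) ^+ 2 + im (f x) ^+ 2))).
  apply: measurable_funM => //; apply: (measurableT_comp (@measurable_expR R)).
  apply: measurable_funN; apply: (measurableT_comp (@measurable_ln R)).
  by apply: measurable_funD; exact: measurable_funX.
apply/funext => x; have [/h0 ->|fx0] := eqVneq (f x) 0; first by rewrite !mul0r.
rewrite expRN lnK// posrE lt_neqAle addr_ge0 ?sqr_ge0// andbT eq_sym.
apply: contra fx0; rewrite paddr_eq0 ?sqr_ge0// !sqrf_eq0 => /andP[/eqP a0 /eqP b0].
by apply/eqP/complexP.
Qed.

Lemma cmeasV f : cmeas f -> cmeas (fun x => (f x)^-1).
Proof.
move=> mf; have [f1 f2] := mf; split.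
- rewrite (_ : (fun _ => _) = fun x => re (f x) / (re (f x) ^+ 2 + im (f x) ^+ 2)).
    by apply: measurable_div_norm2 => // x ->.
  by apply/funext => x; case: (f x).
- rewrite (_ : (fun _ => _) = fun x => (- im (f x)) / (re (f x) ^+ 2 + im (f x) ^+ 2)).
    apply: measurable_div_norm2 => //; first exact: measurable_funN.
    by move=> x ->; rewrite oppr0.
  by apply/funext => x; case: (f x) => a b /=; rewrite mulNr.
Qed.

Lemma cmeas_prod (I : Type) (s : seq I) (f : I -> T -> R[i]) :
  (forall i, cmeas (f i)) -> cmeas (fun x => \prod_(i <- s) f i x).
Proof.
move=> mf; elim: s => [|i s IHs].
  by under eq_fun do rewrite big_nil; exact: cmeas_cst.
by under eq_fun do rewrite big_cons; exact: cmeasM.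
Qed.

Lemma cmeasX f n : cmeas f -> cmeas (fun x => f x ^+ n).
Proof.
move=> mf; elim: n => [|n IHn].
  by under eq_fun do rewrite expr0; exact: cmeas_cst.
by under eq_fun do rewrite exprS; exact: cmeasM.
Qed.

End cmeas.

Lemma cmeas_comp d d' (T : measurableType d) (T' : measurableType d') (f : T -> R[i])
  (g : T' -> T) : measurable_fun setT g -> cmeas f -> cmeas (fun x => f (g x)).
Proof. by move=> mg [f1 f2]; split; [exact: (measurableT_comp f1 mg)|exact: (measurableT_comp f2 mg)]. Qed.

Definition cbounded T (A : set T) (f : T -> R[i]) := exists M, forall x, A x -> normc (f x) <= M.

Lemma cboundedM T (A : set T) f g : cbounded A f -> cbounded A g ->
  cbounded A (fun x => f x * g x).
Proof.
move=> [M hM] [N hN]; exists (M * N) => x Ax; rewrite Normc.normcM.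
by apply: ler_pM; rewrite ?normc_ge0 ?hM ?hN.
Qed.

Lemma cboundedD T (A : set T) f g : cbounded A f -> cbounded A g ->
  cbounded A (fun x => f x + g x).
Proof.
move=> [M hM] [N hN]; exists (M + N) => x Ax.
by apply: (le_trans (le_normcD _ _)); apply: lerD; [exact: hM|exact: hN].
Qed.

Lemma cbounded_cst T (A : set T) z : cbounded A (fun=> z).
Proof. by exists (normc z). Qed.

Lemma cbounded_cexp T (A : set T) f : cbounded A f -> cbounded A (fun x => cexp (f x)).
Proof.
move=> [M hM]; exists (expR M) => x Ax; rewrite normc_cexp ler_expR.
by apply: (le_trans (ler_norm _)); apply: (le_trans (re_le_normc _)); exact: hM.
Qed.

End ComplexToolkit.

(** * Calculus for complex functions of a real variable *)

Section ComplexIntegral.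
Context {R : realType}.
Notation mu := (@lebesgue_measure R).
Notation re := (@complex.Re R).
Notation im := (@complex.Im R).
Notation normc := (@Normc.normc R).
Implicit Types (a b : R) (f g : R -> R[i]).

Definition seg a b : set R := `[a, b]%classic.

Definition cint (D : set R) (f : R -> R[i]) : R[i] :=
  Complex (\int[mu]_(x in D) re (f x)) (\int[mu]_(x in D) im (f x)).

Lemma segment_integrable a b (h : R -> R) M : measurable_fun setT h ->
  (forall x, seg a b x -> `|h x| <= M) -> mu.-integrable (seg a b) (EFin \o h).
Proof.
move=> mh hM.
have mI : measurable (seg a b : set (measurableTypeR R)) by exact: measurable_itv.
apply: (measurable_bounded_integrable mI).
- exact: lebesgue_segment_lty.
- exact: measurable_funTS.
- exists M; split; first exact: num_real.
  by move=> N MN x xD /=; apply: le_trans (ltW MN); exact: hM.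
Qed.

Lemma cint_integrable a b f : cmeas f -> cbounded (seg a b) f ->
  mu.-integrable (seg a b) (EFin \o (fun x => re (f x))) /\
  mu.-integrable (seg a b) (EFin \o (fun x => im (f x))).
Proof.
move=> [f1 f2] [M hM]; split; apply: (segment_integrable (M := M)) => // x xD.
  exact: le_trans (re_le_normc _) (hM _ xD).
exact: le_trans (im_le_normc _) (hM _ xD).
Qed.

Lemma eq_cint (D : set R) f g : (forall x, D x -> f x = g x) -> cint D f = cint D g.
Proof.
by move=> fg; congr Complex; apply: eq_Rintegral => x; rewrite inE => /fg ->.
Qed.

Lemma measurable_seg a b : measurable (seg a b : set (measurableTypeR R)).
Proof. exact: measurable_itv. Qed.
Local Hint Resolve measurable_seg : core.

Lemma cintD a b f g : cmeas f -> cbounded (seg a b) f -> cmeas g -> cbounded (seg a b) g ->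
  cint (seg a b) (fun x => f x + g x) = cint (seg a b) f + cint (seg a b) g.
Proof.
move=> mf bf mg bg; have [f1 f2] := cint_integrable mf bf.
have [g1 g2] := cint_integrable mg bg.
apply: complexP; rewrite ?reD ?imD /=.
  by rewrite -RintegralD//; apply: eq_Rintegral => x _; rewrite reD.
by rewrite -RintegralD//; apply: eq_Rintegral => x _; rewrite imD.
Qed.

Lemma cintZ a b z f : cmeas f -> cbounded (seg a b) f ->
  cint (seg a b) (fun x => z * f x) = z * cint (seg a b) f.
Proof.
move=> mf bf; have [f1 f2] := cint_integrable mf bf.
have iZ (k : R) (h : R -> R) : mu.-integrable (seg a b) (EFin \o h) ->
    mu.-integrable (seg a b) (EFin \o (fun x => k * h x)).
  move=> ih; exact: (integrableZl (measurable_seg a b) k ih).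
apply: complexP; rewrite ?reM ?imM /=.
  rewrite -!RintegralZl// -RintegralB//; [|exact: iZ|exact: iZ].
  by apply: eq_Rintegral => x _; rewrite reM.
rewrite -!RintegralZl// -RintegralD//; [|exact: iZ|exact: iZ].
by apply: eq_Rintegral => x _; rewrite imM.
Qed.

(** The factor 2 comes from estimating the two components separately. It is harmless, because only
    the decay in the order of the pole at 0 is drawn from this bound. *)
Lemma cint_bound a b f M : a <= b -> cmeas f -> 
  (forall x, seg a b x -> normc (f x) <= M) ->
  normc (cint (seg a b) f) <= 2 * M * (b - a).
Proof.
move=> ab mf hM; have [f1 f2] := cint_integrable mf (ex_intro _ M hM).
have H (h : R -> R) : mu.-integrable (seg a b) (EFin \o h) ->
    (forall x, seg a b x -> `|h x| <= M) -> `|\int[mu]_(x in seg a b) h x| <= M * (b - a).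
  move=> ih hhM; apply: (le_trans (le_normr_Rintegral (measurable_seg a b) ih)).
  have -> : M * (b - a) = \int[mu]_(x in seg a b) M.
    rewrite Rintegral_cst// [X in fine X](_ : _ = (b - a)%:E)//.
    transitivity (mu (`[a, b]%classic : set R)) => //.
    rewrite lebesgue_measure_itv/= lte_fin; case: ltrP => [_|ba]/=.
      by rewrite -EFinB.
    have -> : a = b by apply/eqP; rewrite eq_le ab.
    by rewrite subrr.
  apply: le_Rintegral => //.
  - exact: (integrable_norm ih).
  - apply: (segment_integrable (M := `|M|)) => //; exact: measurable_cst.
apply: (le_trans (normc_le _)) => /=; rewrite -mulrA mulr_natl mulr2n; apply: lerD.
  by apply: H => // x xD; exact: le_trans (re_le_normc _) (hM _ xD).
by apply: H => // x xD; exact: le_trans (im_le_normc _) (hM _ xD).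
Qed.

Lemma Rintegral_eq0 (D : set R) (h : R -> R) : (forall x, h x = 0) ->
  \int[mu]_(x in D) h x = 0.
Proof.
by move=> h0; rewrite /Rintegral integral0_eq// => x _; rewrite h0.
Qed.

Lemma Fubini_rectangle (F : R * R -> R) a b c d M : measurable_fun setT F ->
  (forall x y, seg a b x -> seg c d y -> `|F (x, y)| <= M) ->
  \int[mu]_(x in seg a b) \int[mu]_(y in seg c d) F (x, y) =
  \int[mu]_(y in seg c d) \int[mu]_(x in seg a b) F (x, y).
Proof.
move=> mF FM.
pose G := F \_ (seg a b `*` seg c d).
have GE x y : G (x, y) = if (x \in seg a b) && (y \in seg c d) then F (x, y) else 0.
  by rewrite /G patchE in_setX.
have E1 : \int[mu]_(x in seg a b) \int[mu]_(y in seg c d) F (x, y) =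
    \int[mu]_x \int[mu]_y G (x, y).
  rewrite Rintegral_mkcond; apply: eq_Rintegral => x _; rewrite patchE.
  case: ifPn => xab.
    rewrite Rintegral_mkcond; apply: eq_Rintegral => y _.
    by rewrite patchE GE xab.
  by apply/esym/Rintegral_eq0 => y; rewrite GE (negbTE xab).
have E2 : \int[mu]_(y in seg c d) \int[mu]_(x in seg a b) F (x, y) =
    \int[mu]_y \int[mu]_x G (x, y).
  rewrite Rintegral_mkcond; apply: eq_Rintegral => y _; rewrite patchE.
  case: ifPn => ycd.
    rewrite Rintegral_mkcond; apply: eq_Rintegral => x _.
    by rewrite patchE GE ycd andbT.
  by apply/esym/Rintegral_eq0 => x; rewrite GE (negbTE ycd) andbF.
rewrite E1 E2.
(* One constant dominating the values of [G] as well as both coordinates on its support, as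
   [Fubini_cbm] asks for. *)
pose N := `|M| + (`|a| + `|b| + `|c| + `|d|).
have segN u v x : seg u v x -> `|x| <= `|u| + `|v|.
  rewrite /seg/= in_itv/= => /andP[ux xv]; rewrite ler_norml.
  have := ler_norm v; have := ler_norm (- u); rewrite normrN.
  by have := normr_ge0 u; have := normr_ge0 v => *; apply/andP; split; lra.
apply: (@Fubini_cbm _ _ N).
- apply: (measurable_restrictT _ _).1; last exact: measurable_funTS.
  by apply: measurableX; exact: measurable_itv.
- have hN : `|M| <= N by rewrite lerDl !addr_ge0.
  have N0 : 0 <= N by rewrite !addr_ge0.
  move=> [x y]; rewrite GE; case: ifPn => [/andP[]|_]; last by rewrite normr0.
  rewrite !inE => xD yD; apply: le_trans hN; apply: le_trans (ler_norm _).
  exact: FM.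
- move=> [x y]; rewrite GE; case: ifPn => [/andP[]|_]; last by rewrite eqxx.
  rewrite !inE => /segN xD /segN yD _ /=; rewrite /N.
  have := normr_ge0 M; have := normr_ge0 a; have := normr_ge0 b.
  by have := normr_ge0 c; have := normr_ge0 d => *; split; lra.
Qed.

Lemma cint_Fubini (F : R * R -> R[i]) a b c d : cmeas F ->
  cbounded (seg a b `*` seg c d) F ->
  cint (seg a b) (fun x => cint (seg c d) (fun y => F (x, y))) =
  cint (seg c d) (fun y => cint (seg a b) (fun x => F (x, y))).
Proof.
move=> [F1 F2] [M hM]; apply: complexP => /=.
  apply: (@Fubini_rectangle (fun z => re (F z)) _ _ _ _ M) => // x y xD yD.
  by apply: (le_trans (re_le_normc _)); apply: hM.
apply: (@Fubini_rectangle (fun z => im (F z)) _ _ _ _ M) => // x y xD yD.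
by apply: (le_trans (im_le_normc _)); apply: hM.
Qed.

Definition cderive f f' := forall x : R,
  is_derive x 1 (fun x => re (f x)) (re (f' x)) /\
  is_derive x 1 (fun x => im (f x)) (im (f' x)).

Lemma Rintegral_FTC (h h' : R -> R) a b : a <= b ->
  (forall x : R, is_derive x 1 h (h' x)) -> continuous h' ->
  \int[mu]_(x in seg a b) h' x = h b - h a.
Proof.
move=> ab dh ch'; move: ab; rewrite le_eqVlt => /predU1P[<-|ab].
  by rewrite /seg set_itv1 Rintegral_set1 subrr.
have ch : continuous h.
  by move=> x; apply/differentiable_continuous/derivable1_diffP; case: (dh x).
rewrite /Rintegral (@continuous_FTC2 _ h' h)//.
- exact: continuous_subspaceT.
- split.
  + by move=> x _; case: (dh x).
  + by apply: cvg_at_right_filter; exact: ch.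
  + by apply: cvg_at_left_filter; exact: ch.
- by move=> x _; rewrite derive1E; case: (dh x).
Qed.

(** The second derivative [f''] supplies the continuity of [f'] that the fundamental theorem of
    calculus requires. *)
Lemma cint_FTC f f' f'' a b : a <= b -> cderive f f' -> cderive f' f'' ->
  cint (seg a b) f' = f b - f a.
Proof.
move=> ab df df'; apply: complexP; rewrite ?reD ?imD.
  rewrite /= (Rintegral_FTC ab (fun x => proj1 (df x))); first by case: (f a).
  move=> x; apply/differentiable_continuous/derivable1_diffP.
  by case: (df' x) => -[].
rewrite /= (Rintegral_FTC ab (fun x => proj2 (df x))); first by case: (f a).
move=> x; apply/differentiable_continuous/derivable1_diffP.
by case: (df' x) => _ -[].
Qed.

Lemma cderiveM f f' g g' : cderive f f' -> cderive g g' ->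
  cderive (fun x => f x * g x) (fun x => f' x * g x + f x * g' x).
Proof.
move=> df dg x; have [f1 f2] := df x; have [g1 g2] := dg x; split.
  under eq_fun do rewrite reM.
  apply: is_derive_eq; rewrite reD !reM /GRing.scale/=; ring.
under eq_fun do rewrite imM.
apply: is_derive_eq; rewrite imD !imM /GRing.scale/=; ring.
Qed.

Lemma cderive_cst z : cderive (fun=> z) (fun=> 0).
Proof. by move=> x; split; exact: is_derive_cst. Qed.

Lemma cderiveZ z f f' : cderive f f' -> cderive (fun x => z * f x) (fun x => z * f' x).
Proof.
move=> df; have := cderiveM (cderive_cst z) df.
by under [X in cderive _ X]eq_fun do rewrite mul0r add0r.
Qed.

Lemma cderive_linear z w : cderive (fun x => z * x%:C + w) (fun=> z).
Proof.
move=> x; split.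
  under eq_fun do rewrite reD reM /= mulr0 subr0.
  by apply: is_derive_eq; rewrite /GRing.scale/=; ring.
under eq_fun do rewrite imD imM /= mulr0 add0r.
by apply: is_derive_eq; rewrite /GRing.scale/=; ring.
Qed.

Lemma cderive_cexp f f' : cderive f f' ->
  cderive (fun x => cexp (f x)) (fun x => f' x * cexp (f x)).
Proof.
move=> df x; have [f1 f2] := df x.
have E := is_derive1_comp (is_derive_expR (re (f x))) f1.
have C := is_derive1_comp (is_derive_cos (im (f x))) f2.
have S := is_derive1_comp (is_derive_sin (im (f x))) f2.
split.
  rewrite (_ : (fun _ => _) = (expR \o (fun x => re (f x))) * (cos \o (fun x => im (f x)))).
    apply: is_derive_eq; rewrite reM /=; case: (f x) => p q /=.
    by rewrite /GRing.scale/=; ring.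
  by apply/funext => u /=; rewrite /GRing.mul/=; case: (f u).
rewrite (_ : (fun _ => _) = (expR \o (fun x => re (f x))) * (sin \o (fun x => im (f x)))).
  apply: is_derive_eq; rewrite imM /=; case: (f x) => p q /=.
  by rewrite /GRing.scale/=; ring.
by apply/funext => u /=; rewrite /GRing.mul/=; case: (f u).
Qed.

End ComplexIntegral.

(** * Contour integrals *)

Section Contour.
Context {R : realType}.
Notation mu := (@lebesgue_measure R).
Notation re := (@complex.Re R).
Notation im := (@complex.Im R).
Notation normc := (@Normc.normc R).
Variable r : R.
Hypothesis r0 : 0 < r.
Notation ci := (@ci R).

Definition circ (th : R) : R[i] := r%:C * cexp (Complex 0 th).
Definition dcirc th : R[i] := ci * circ th.
Local Notation I := (seg 0 (2 * pi : R)).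

Definition oint (f : R[i] -> R[i]) : R[i] := cint I (fun th => f (circ th) * dcirc th).

Lemma circle_integralE f : circle_integral f r = oint f.
Proof.
rewrite /circle_integral /oint /cint /dcirc /circ.
by congr Complex; apply: eq_Rintegral => th _; rewrite !mulrA.
Qed.

Lemma pi2_ge0 : 0 <= 2 * pi :> R.
Proof. by rewrite mulr_ge0// pi_ge0. Qed.

Lemma normc_circ th : normc (circ th) = r.
Proof. by rewrite Normc.normcM normc_cexp normc_real /= expR0 mulr1 gtr0_norm. Qed.

Lemma circ_neq0 th : circ th != 0.
Proof.
apply/eqP => /(congr1 normc); rewrite normc_circ Normc.normc0 => /eqP.
by rewrite gt_eqF.
Qed.

Lemma normc_circB th (a : R) : r - `|a| <= normc (circ th - a%:C).
Proof.
rewrite lerBlDr -{1}(normc_circ th) -(normc_real a) -{1}(subrK a%:C (circ th)).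
exact: le_normcD.
Qed.

Lemma circB_neq0 th (a : R) : `|a| < r -> circ th - a%:C != 0.
Proof.
rewrite -subr_gt0 => ar; apply/eqP => h.
by have := normc_circB th a; rewrite h Normc.normc0 leNgt ar.
Qed.

(** The summand 0 brings the exponent into the form handled by [cderive_linear]. *)
Lemma circE th : circ th = r%:C * cexp (ci * th%:C + 0).
Proof.
rewrite /circ; congr (_ * cexp _).
by apply: complexP; rewrite addr0 ?reM ?imM /=; ring.
Qed.

Lemma cmeas_circ : cmeas circ.
Proof.
apply: cmeasM; first exact: cmeas_cst.
by apply: cmeas_cexp; split => /=; [exact: measurable_cst|exact: measurable_id].
Qed.

Lemma cmeas_dcirc : cmeas dcirc.
Proof. by apply: cmeasM; [exact: cmeas_cst|exact: cmeas_circ]. Qed.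

Lemma cbounded_circ : cbounded setT circ.
Proof. by exists r => th _; rewrite normc_circ. Qed.

Lemma normc_ci : normc ci = 1.
Proof. by rewrite /= expr0n/= add0r expr1n sqrtr1. Qed.

Lemma ci_neq0 : ci != 0.
Proof.
apply/eqP => /(congr1 normc); rewrite normc_ci Normc.normc0 => /eqP.
by rewrite oner_eq0.
Qed.

Lemma normc_dcirc th : normc (dcirc th) = r.
Proof. by rewrite Normc.normcM normc_circ normc_ci mul1r. Qed.

Lemma cbounded_dcirc : cbounded setT dcirc.
Proof. by exists r => th _; rewrite normc_dcirc. Qed.

Lemma cderive_circ : cderive circ dcirc.
Proof.
have H := cderiveZ r%:C (cderive_cexp (cderive_linear ci 0)).
rewrite (_ : circ = fun th => r%:C * cexp (ci * th%:C + 0)); last exact/funext/circE.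
rewrite (_ : dcirc = fun th => r%:C * (ci * cexp (ci * th%:C + 0)))//.
by apply/funext => th; rewrite /dcirc circE mulrCA.
Qed.

Lemma cderive_dcirc : cderive dcirc (fun th => ci * dcirc th).
Proof. exact: cderiveZ cderive_circ. Qed.

Lemma circ_2pi : circ (2 * pi) = circ 0.
Proof.
rewrite /circ; congr (_ * _); rewrite /= !expR0 mulr_natl cos2pi sin2pi.
by rewrite cos0 sin0.
Qed.

Lemma cexpN (z : R[i]) : cexp (- z) = (cexp z)^-1.
Proof. by apply: (mulfI (cexp_neq0 z)); rewrite -cexpD subrr cexp0 divff// cexp_neq0. Qed.

Lemma cexp_natM n (z : R[i]) : cexp (n%:R * z) = cexp z ^+ n.
Proof.
elim: n => [|n IHn]; first by rewrite mul0r cexp0 expr0.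
by rewrite -natr1 mulrDl mul1r cexpD IHn exprSr.
Qed.

Lemma cexp_2pi : cexp (ci * (2 * pi)%:C) = 1.
Proof.
rewrite (_ : ci * _ = Complex 0 (2 * pi)).
  by rewrite /= expR0 mulr_natl cos2pi sin2pi !mul1r.
by apply: complexP; rewrite ?reM ?imM /=; ring.
Qed.

Lemma cint_cst (a b : R) (z : R[i]) : a <= b -> cint (seg a b) (fun=> z) = (b - a)%:C * z.
Proof.
move=> ab.
have m : fine (mu (`[a, b]%classic : set R)) = b - a.
  rewrite lebesgue_measure_itv/= lte_fin; case: ltrP => [_|ba]//=.
  by have -> : a = b; [apply/eqP; rewrite eq_le ab|rewrite subrr].
apply: complexP; rewrite ?reM ?imM /= (Rintegral_cst _ (measurable_seg a b)).
  by rewrite mul0r subr0 mulrC [X in X * _](_ : _ = b - a).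
by rewrite mul0r addr0 mulrC [X in X * _](_ : _ = b - a).
Qed.

(** The additional pole of order [m] at 0 is the induction parameter for rational integrands; the
    exponential integrals take [m = 0]. *)
Definition polepart (l : seq R) (m : nat) th : R[i] :=
  circ th ^- m * \prod_(a <- l) (circ th - a%:C)^-1.

Definition pole_integral l m := cint I (fun th => polepart l m th * dcirc th).

Lemma cmeas_polepart l m : cmeas (polepart l m).
Proof.
apply: cmeasM; first by apply: cmeasV; apply: cmeasX; exact: cmeas_circ.
apply: cmeas_prod => a; apply: cmeasV; apply: cmeasD; first exact: cmeas_circ.
exact: cmeas_cst.
Qed.

(** On the circle |z - a| >= r - |a| > 0, so [C] is the product of the 1/(r - |a|). That it does not
    depend on [m] is what the decay argument rests on. *)
Lemma polepart_bound l : all (fun a => `|a| < r) l ->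
  exists2 C, 0 <= C & forall m th, normc (polepart l m th) <= C * (r^-1) ^+ m.
Proof.
elim: l => [_|a l IHl /= /andP[ar /IHl[C C0 hC]]].
  by exists 1 => // m th; rewrite /polepart big_nil mulr1 mul1r Normc.normcV normcX normc_circ exprVn.
exists (C * (r - `|a|)^-1) => [|m th].
  by rewrite mulr_ge0// invr_ge0 subr_ge0 ltW.
rewrite /polepart big_cons mulrCA mulrC Normc.normcM mulrAC.
apply: ler_pM; rewrite ?normc_ge0//; first exact: hC.
rewrite Normc.normcV lef_pV2 ?posrE ?subr_gt0//; first exact: normc_circB.
exact/normc_gt0/circB_neq0.
Qed.

Lemma cbounded_polepart A l m : all (fun a => `|a| < r) l -> cbounded A (polepart l m).
Proof. by move=> /polepart_bound[C _ hC]; exists (C * (r^-1) ^+ m). Qed.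

Lemma cboundedT T (A : set T) (f : T -> R[i]) : cbounded [set: T] f -> cbounded A f.
Proof. by move=> [M hM]; exists M => x _; exact: hM. Qed.

Lemma pole_integral_bound l : all (fun a => `|a| < r) l ->
  exists2 C, 0 <= C & forall m, normc (pole_integral l m) <= C * (r^-1) ^+ m.
Proof.
move=> /polepart_bound[C C0 hC]; exists (2 * (C * r) * (2 * pi - 0)) => [|m].
  by rewrite subr0 !mulr_ge0// ?pi_ge0// ltW.
have := @cint_bound _ 0 (2 * pi) (fun th => polepart l m th * dcirc th) (C * (r^-1) ^+ m * r) pi2_ge0.
rewrite (_ : 2 * (C * r^-1 ^+ m * r) * (2 * pi - 0) = 2 * (C * r) * (2 * pi - 0) * r^-1 ^+ m); last by ring.
apply; first by apply: cmeasM; [exact: cmeas_polepart|exact: cmeas_dcirc].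
by move=> th _; rewrite Normc.normcM normc_dcirc ler_wpM2r// ltW.
Qed.

Lemma pole_integral_cons a l m : `|a| < r -> all (fun a => `|a| < r) l ->
  pole_integral (a :: l) m = pole_integral l m.+1 + a%:C * pole_integral (a :: l) m.+1.
Proof.
move=> ar lr.
have al : all (fun a => `|a| < r) (a :: l) by rewrite /= ar.
have b l' k : all (fun a => `|a| < r) l' -> cbounded I (fun th => polepart l' k th * dcirc th).
  move=> hl; apply: cboundedM; first exact: cbounded_polepart.
  exact/cboundedT/cbounded_dcirc.
have m' l' k : cmeas (fun th => polepart l' k th * dcirc th).
  by apply: cmeasM; [exact: cmeas_polepart|exact: cmeas_dcirc].
rewrite /pole_integral -cintZ; [|exact: m'|exact: b].
rewrite -cintD; [|exact: m'|exact: b| |]; last 2 first.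
- by apply: cmeasM; [exact: cmeas_cst|exact: m'].
- by apply: cboundedM; [exact: cbounded_cst|exact: b].
apply: eq_cint => th _; rewrite mulrA -mulrDl; congr (_ * _).
rewrite /polepart big_cons exprSr invfM.
have := circ_neq0 th; have := circB_neq0 th ar; set z := circ th => za z0.
set P := \prod_(_ <- _) _; set Q := (z ^+ m)^-1.
by move: a%:C za => A za; field; rewrite za z0.
Qed.

(** Along the circle dz = i z dth, so the integrand is i z^(-m): constant for [m = 0], and otherwise
    an exponential of frequency -m whose primitive is periodic. *)
Lemma pole_integral_nil m : pole_integral [::] m.+1 = if m == 0%N then 2 * pi%:C * ci else 0.
Proof.
case: m => [|k]; rewrite /pole_integral /=.
  rewrite (@eq_cint _ _ _ (fun=> ci)) => [|th _]; last first.
    by rewrite /polepart big_nil mulr1 expr1 /dcirc mulrCA mulVf ?circ_neq0// mulr1.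
  by rewrite cint_cst ?pi2_ge0// subr0 rmorphM rmorph_nat.
pose al : R[i] := - k.+1%:R * ci.
have al0 : al != 0 by rewrite mulf_neq0 ?ci_neq0// oppr_eq0 pnatr_eq0.
have E th : I th -> polepart [::] k.+2 th * dcirc th = (ci * r%:C ^- k.+1 * al^-1) * (al * cexp (al * th%:C + 0)).
  move=> _; rewrite /polepart big_nil mulr1 /dcirc mulrCA.
  have -> : circ th ^- k.+2 * circ th = circ th ^- k.+1.
    by rewrite exprSr invfM -mulrA mulVf ?circ_neq0// mulr1.
  rewrite -[RHS]mulrA (mulKf al0) -[RHS]mulrA circE exprMn invfM -cexp_natM -cexpN.
  by congr (_ * (_ * cexp _)); rewrite /al; ring.
rewrite (eq_cint E).
have D : cderive (fun th => cexp (al * th%:C + 0)) (fun th => al * cexp (al * th%:C + 0)).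
  exact: (cderive_cexp (cderive_linear al 0)).
rewrite cintZ.
- rewrite (cint_FTC pi2_ge0 D (cderiveZ al D)).
  rewrite !addr0 [0%:C](_ : _ = 0)// mulr0 cexp0 /al !mulNr cexpN -[_ * ci * _]mulrA cexp_natM.
  by rewrite cexp_2pi expr1n invr1 subrr mulr0.
- apply: cmeasM; first exact: cmeas_cst.
  apply: cmeas_cexp; apply: cmeasD; last exact: cmeas_cst.
  apply: cmeasM; first exact: cmeas_cst.
  by apply: cmeas_real; exact: measurable_id.
- apply: cboundedM; first exact: cbounded_cst.
  apply: cbounded_cexp; apply: cboundedD; last exact: cbounded_cst.
  apply: cboundedM; first exact: cbounded_cst.
  exists (2 * pi) => x; rewrite /seg/= in_itv/= expr0n/= addr0 sqrtr_sqr => /andP[x0 ?].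
  by rewrite ger0_norm.
Qed.

Lemma geometric_le_eq0 (x C q : R) : 0 <= x -> 0 <= q -> q < 1 ->
  (forall k, x <= C * q ^+ k) -> x = 0.
Proof.
move=> x0 q0 q1 h; apply/eqP; rewrite eq_le x0 andbT.
have qn : `|q| < 1 by rewrite ger0_norm.
have cv : (C * q ^+ k) @[k --> \oo] --> C * 0 by apply: cvgMr; exact: cvg_expr.
rewrite -[leRHS](mulr0 C) -(cvg_lim _ cv)//; apply: limr_ge; first by apply/cvg_ex; eexists; exact: cv.
by near=> k; exact: h.
Unshelve. all: end_near. Qed.

(* 1/(z - a) = 1/z + a/(z (z - a)), iterated; the remainder decays like (|a|/r)^k. *)
Theorem pole_integralE l m : all (fun a => `|a| < r) l -> (0 < m + size l)%N ->
  pole_integral l m = if (m + size l == 1)%N then 2 * pi%:C * ci else 0.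
Proof.
elim: l m => [|a l IHl] m.
  by rewrite addn0; case: m => // m _ _; rewrite pole_integral_nil.
move=> /= /andP[ar lr] _.
have al : all (fun a => `|a| < r) (a :: l) by rewrite /= ar.
have [C C0 hC] := pole_integral_bound al.
(* The other term has a pole of order [k.+2] at 0, hence at least two poles, and vanishes by
   induction. *)
have S k : pole_integral (a :: l) k.+1 = a%:C * pole_integral (a :: l) k.+2.
  by rewrite pole_integral_cons// IHl// !addSn/= add0r.
have P k : pole_integral (a :: l) 1 = a%:C ^+ k * pole_integral (a :: l) k.+1.
  elim: k => [|k IHk]; first by rewrite expr0 mul1r.
  by rewrite IHk S exprSr mulrA.
have J1 : pole_integral (a :: l) 1 = 0.
  apply: Normc.eq0_normc; apply: (@geometric_le_eq0 _ (C * r^-1) (`|a| * r^-1)).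
  - exact: normc_ge0.
  - by rewrite mulr_ge0// invr_ge0 ltW.
  - by rewrite ltr_pdivrMr// mul1r.
  move=> k; rewrite (P k) Normc.normcM normcX normc_real.
  have -> : C * r^-1 * (`|a| / r) ^+ k = `|a| ^+ k * (C * r^-1 ^+ k.+1).
    by rewrite exprMn exprS; ring.
  by rewrite ler_wpM2l// exprn_ge0.
(* [P] and [J1] leave two cases: the integral is 0, or [a] is 0 and one application of [S]
   concludes. *)
have JS k : pole_integral (a :: l) k.+1 = 0.
  have := P k; rewrite J1 => /esym/eqP; rewrite mulf_eq0 => /orP[|/eqP//].
  rewrite expf_eq0 => /andP[_ /eqP a0].
  by rewrite S a0 mul0r.
case: m => [|m]; last by rewrite JS addSn addnS.
(* What is left is [pole_integral l 1], which is 2 pi i precisely when [l] is empty. *)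
by rewrite pole_integral_cons// JS mulr0 addr0 IHl// add0n add1n.
Qed.

End Contour.

(** * Contour integrals of an exponential over linear factors *)

Section ExponentialContour.
Context {R : realType}.
Notation re := (@complex.Re R).
Notation im := (@complex.Im R).
Notation normc := (@Normc.normc R).
Notation ci := (@ci R).
Variables (r k : R).
Hypotheses (r0 : 0 < r) (k0 : k != 0).
Local Notation I := (seg 0 (2 * pi : R)).
Local Notation kc := (k%:C * ci).
Local Notation near0 := (all (fun a => `|a| < r)).

Definition ek (z : R[i]) : R[i] := cexp (- kc * z).

Lemma ekD z w : ek (z + w) = ek z * ek w.
Proof. by rewrite /ek mulrDr cexpD. Qed.

Lemma cmeas_ek d (T : measurableType d) (f : T -> R[i]) : cmeas f -> cmeas (fun x => ek (f x)).
Proof. by move=> mf; apply: cmeas_cexp; apply: cmeasM => //; exact: cmeas_cst. Qed.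

Lemma cbounded_ek T (A : set T) (f : T -> R[i]) : cbounded A f -> cbounded A (fun x => ek (f x)).
Proof. by move=> bf; apply: cbounded_cexp; apply: cboundedM => //; exact: cbounded_cst. Qed.

Definition exp_integral (l : seq R) (s : R) : R[i] :=
  cint I (fun th => ek (s%:C * circ r th) * polepart r l 0 th * dcirc r th).

Lemma kc_neq0 : kc != 0.
Proof.
by rewrite mulf_neq0 ?ci_neq0//; apply: contra k0 => /eqP/complexI/eqP.
Qed.

(** The exponents add up to [kc * (z - a) * x - kc * s * z], so integrating in [x] divides by
    [kc * (z - a)]: this is the origin of both the new pole and the factor 1/c in the recursion. *)
Lemma cint_ek a z s : 0 <= s -> `|a| < r -> (exists th, z = circ r th) ->
  cint (seg 0 s) (fun x => ek (a%:C * x%:C) * ek ((s - x)%:C * z)) =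
  kc^-1 * (z - a%:C)^-1 * (ek (s%:C * a%:C) - ek (s%:C * z)).
Proof.
move=> s0 ar [th zE]; have za : z - a%:C != 0 by rewrite zE circB_neq0.
pose al := kc * (z - a%:C); pose be := - kc * s%:C * z.
have al0 : al != 0 by rewrite mulf_neq0// kc_neq0.
have E x : seg 0 s x -> ek (a%:C * x%:C) * ek ((s - x)%:C * z) =
    (kc^-1 * (z - a%:C)^-1) * (al * cexp (al * x%:C + be)).
  move=> _; rewrite mulrA -invfM -/al mulVf// mul1r.
  rewrite -ekD /ek; congr cexp; rewrite /al /be rmorphB/=; ring.
rewrite (eq_cint E).
have D : cderive (fun x => cexp (al * x%:C + be)) (fun x => al * cexp (al * x%:C + be)).
  exact: (cderive_cexp (cderive_linear al be)).
rewrite cintZ.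
- rewrite (cint_FTC s0 D (cderiveZ al D)); congr (_ * (_ - _)).
    by rewrite /ek; congr cexp; rewrite /al /be; ring.
  by rewrite /ek [0%:C](_ : _ = 0)// mulr0 add0r /be mulrA.
- apply: cmeasM; first exact: cmeas_cst.
  apply: cmeas_cexp; apply: cmeasD; last exact: cmeas_cst.
  apply: cmeasM; first exact: cmeas_cst.
  by apply: cmeas_real; exact: measurable_id.
- apply: cboundedM; first exact: cbounded_cst.
  apply: cbounded_cexp; apply: cboundedD; last exact: cbounded_cst.
  apply: cboundedM; first exact: cbounded_cst.
  exists s => x; rewrite /seg/= in_itv/= expr0n/= addr0 sqrtr_sqr => /andP[x0 ?].
  by rewrite ger0_norm.
Qed.

Lemma cmeas_exp_integrand l s : cmeas (fun th => ek (s%:C * circ r th) * polepart r l 0 th * dcirc r th).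
Proof.
apply: cmeasM; last exact: cmeas_dcirc.
apply: cmeasM; last exact: cmeas_polepart.
by apply: cmeas_ek; apply: cmeasM; [exact: cmeas_cst|exact: cmeas_circ].
Qed.

Lemma cbounded_exp_integrand A l s : near0 l ->
  cbounded A (fun th => ek (s%:C * circ r th) * polepart r l 0 th * dcirc r th).
Proof.
move=> lr; apply: cboundedM; last exact/cboundedT/cbounded_dcirc.
apply: cboundedM; last exact: cbounded_polepart.
apply: cbounded_ek; apply: cboundedM; first exact: cbounded_cst.
exact/cboundedT/cbounded_circ.
Qed.

(* c stays inside the integral: pulling it out would require measurability of
   x |-> exp_integral l (s - x). *)
Lemma cint_exp_integral_poles c a l s : 0 <= s -> `|a| < r -> near0 l ->
  cint (seg 0 s) (fun x => c * ek (a%:C * x%:C) * exp_integral l (s - x)) =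
  c * kc^-1 * (ek (s%:C * a%:C) * pole_integral r (a :: l) 0 - exp_integral (a :: l) s).
Proof.
move=> s0 ar lr; have al : near0 (a :: l) by rewrite /= ar.
pose F (z : R * R) 
  := c * ek (a%:C * z.1%:C) * (ek ((s - z.1)%:C * circ r z.2) * polepart r l 0 z.2 * dcirc r z.2).
have m1 : cmeas (fun z : R * R => z.1%:C) by apply: cmeas_real; exact: measurable_fst.
have mF : cmeas F.
  apply: cmeasM.
    apply: cmeasM; first exact: cmeas_cst.
    by apply: cmeas_ek; apply: cmeasM => //; exact: cmeas_cst.
  apply: cmeasM; last exact: (cmeas_comp measurable_snd (cmeas_dcirc r)).
  apply: cmeasM; last exact: (cmeas_comp measurable_snd (cmeas_polepart r l 0)).
  apply: cmeas_ek; apply: cmeasM; last exact: (cmeas_comp measurable_snd (cmeas_circ r)).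
  apply: cmeas_real; apply: measurable_funB; first exact: measurable_cst.
  exact: measurable_fst.
have b2 (f : R -> R[i]) : cbounded setT f -> cbounded (seg 0 s `*` I) (fun z => f z.2).
  by move=> [M hM]; exists M => -[x y] _; exact: hM.
have b1 (h : R -> R) : (forall x, seg 0 s x -> `|h x| <= s) ->
    cbounded (seg 0 s `*` I) (fun z => (h z.1)%:C).
  by move=> hs; exists s => -[x y] [/= xs _]; rewrite expr0n/= addr0 sqrtr_sqr; exact: hs.
have bF : cbounded (seg 0 s `*` I) F.
  apply: cboundedM.
    apply: cboundedM; first exact: cbounded_cst.
    apply: cbounded_ek; apply: cboundedM; first exact: cbounded_cst.
    apply: (b1 id) => x; rewrite /seg/= in_itv/= => /andP[x0 xs].
    by rewrite ger0_norm.
  apply: cboundedM; last exact/b2/cbounded_dcirc.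
  apply: cboundedM; last exact/(b2 (polepart r l 0))/cbounded_polepart.
  apply: cbounded_ek; apply: cboundedM; last exact/b2/cbounded_circ.
  apply: (b1 (fun x => s - x)) => x; rewrite /seg/= in_itv/= => /andP[x0 xs].
  by rewrite ger0_norm ?subr_ge0// gerBl.
transitivity (cint (seg 0 s) (fun x => cint I (fun th => F (x, th)))).
  apply: eq_cint => x _; rewrite /F /= cintZ//; first exact: cmeas_exp_integrand.
  exact: cbounded_exp_integrand.
rewrite cint_Fubini//.
(* Of the two end point terms of [cint_ek], the one with [ek (s%:C * a%:C)] is constant along the
   circle and leaves a purely rational integrand; the other is the integrand of
   [exp_integral (a :: l) s]. *)
transitivity (cint I (fun th => c * kc^-1 * (ek (s%:C * a%:C) * (polepart r (a :: l) 0 th * dcirc r th)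
  + - 1 * (ek (s%:C * circ r th) * polepart r (a :: l) 0 th * dcirc r th)))).
  apply: eq_cint => th _.
  transitivity (cint (seg 0 s) (fun x => (c * (polepart r l 0 th * dcirc r th)) *
      (ek (a%:C * x%:C) * ek ((s - x)%:C * circ r th)))).
    by apply: eq_cint => x _; rewrite /F /=; ring.
  rewrite cintZ.
  - rewrite cint_ek//; last by exists th.
    by rewrite /polepart big_cons; ring.
  - apply: cmeasM; apply: cmeas_ek; apply: cmeasM; try exact: cmeas_cst.
      by apply: cmeas_real; exact: measurable_id.
    by apply: cmeas_real; apply: measurable_funB; [exact: measurable_cst|exact: measurable_id].
  - apply: cboundedM; apply: cbounded_ek; apply: cboundedM; try exact: cbounded_cst.
      exists s => x; rewrite /seg/= in_itv/= expr0n/= addr0 sqrtr_sqr => /andP[x0 ?].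
      by rewrite ger0_norm.
    exists s => x; rewrite /seg/= in_itv/= expr0n/= addr0 sqrtr_sqr => /andP[x0 ?].
    by rewrite ger0_norm ?subr_ge0// gerBl.
have mJ : cmeas (fun th => polepart r (a :: l) 0 th * dcirc r th).
  by apply: cmeasM; [exact: cmeas_polepart|exact: cmeas_dcirc].
have bJ : cbounded I (fun th => polepart r (a :: l) 0 th * dcirc r th).
  by apply: cboundedM; [exact: cbounded_polepart|exact/cboundedT/cbounded_dcirc].
have mG := cmeas_exp_integrand (a :: l) s; have bG := cbounded_exp_integrand I s al.
rewrite cintZ.
- rewrite cintD; last 4 first.
  + by apply: cmeasM => //; exact: cmeas_cst.
  + by apply: cboundedM => //; exact: cbounded_cst.
  + by apply: cmeasM => //; exact: cmeas_cst.
  + by apply: cboundedM => //; exact: cbounded_cst.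
  by rewrite !cintZ// mulN1r.
- by apply: cmeasD; apply: cmeasM => //; exact: cmeas_cst.
- by apply: cboundedD; apply: cboundedM => //; exact: cbounded_cst.
Qed.

(** The exponential has a primitive and the circle closes up. That primitive is divided by [s], so
    [s = 0] is treated apart, with [circ r] itself as primitive. *)
Lemma exp_integral_nil s : exp_integral [::] s = 0.
Proof.
have D := cderive_circ r.
have [->|s0] := eqVneq s 0.
  rewrite /exp_integral (@eq_cint _ _ _ (dcirc r)) => [|th _]; last first.
    by rewrite /polepart big_nil expr0 invr1 mulr1 [0%:C](_ : _ = 0)// mul0r /ek mulr0 cexp0 !mul1r.
  by rewrite (cint_FTC (@pi2_ge0 R) D (cderive_dcirc r)) circ_2pi subrr.
pose al := - kc * s%:C.
have al0 : al != 0.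
  rewrite mulf_neq0 ?oppr_eq0 ?kc_neq0//.
  by apply: contra s0 => /eqP/complexI/eqP.
have E th : I th -> ek (s%:C * circ r th) * polepart r [::] 0 th * dcirc r th =
    al^-1 * (al * dcirc r th * cexp (al * circ r th)).
  move=> _; rewrite /polepart big_nil expr0 invr1 !mulr1 -[al * _ * _]mulrA mulKf//.
  by rewrite /ek /al mulrC -[- _ * _ * _]mulrA.
rewrite /exp_integral (eq_cint E).
have D1 := cderive_cexp (cderiveZ al D).
have D2 := cderiveM (cderiveZ al (cderive_dcirc r)) D1.
rewrite cintZ.
- by rewrite (cint_FTC (@pi2_ge0 R) D1 D2) circ_2pi subrr mulr0.
- apply: cmeasM; first by apply: cmeasM; [exact: cmeas_cst|exact: cmeas_dcirc].
  by apply: cmeas_cexp; apply: cmeasM; [exact: cmeas_cst|exact: cmeas_circ].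
- apply: cboundedM; first by apply: cboundedM; [exact: cbounded_cst|exact/cboundedT/cbounded_dcirc].
  by apply: cbounded_cexp; apply: cboundedM; [exact: cbounded_cst|exact/cboundedT/cbounded_circ].
Qed.

(** Cauchy's formula for the exponential, read off the recursion at the empty list: the left-hand
    side vanishes by [exp_integral_nil], which equates the two terms on the right, and a single pole
    contributes 2 pi i. *)
Lemma exp_integral_seq1 a s : 0 <= s -> `|a| < r -> exp_integral [:: a] s = 2 * pi%:C * ci * ek (s%:C * a%:C).
Proof.
move=> s0 ar; have := @cint_exp_integral_poles 1 a [::] s s0 ar isT.
rewrite (@eq_cint _ _ _ (fun=> 0)) => [|x _]; last by rewrite exp_integral_nil mulr0.
rewrite cint_cst// mulr0 pole_integralE//= ?ar// => /esym/eqP.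
rewrite mul1r mulf_eq0 invr_eq0 (negbTE kc_neq0)/= subr_eq0 => /eqP <-.
by rewrite mulrC.
Qed.

(** With [l] nonempty the list [a :: l] has two poles or more, so the rational term drops out. *)
Lemma cint_exp_integral c a l s : 0 <= s -> `|a| < r -> near0 l -> l != [::] ->
  cint (seg 0 s) (fun x => c * ek (a%:C * x%:C) * exp_integral l (s - x)) = c * - kc^-1 * exp_integral (a :: l) s.
Proof.
move=> s0 ar lr l0; rewrite cint_exp_integral_poles// pole_integralE//= ?ar//.
by case: l l0 {lr} => // b l _; rewrite /= mulr0 add0r !mulrN mulNr.
Qed.

End ExponentialContour.

(** * Simplices *)

Section StandardSimplex.
Context {R : realType}.
Notation mu := (@lebesgue_measure R).
Notation re := (@complex.Re R).
Notation im := (@complex.Im R).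
Notation ci := (@ci R).

Definition corner n (s : R) (w : 'rV[R]_n) : bool :=
  [forall i, 0 <= w 0 i] && (\sum_i w 0 i <= s).

Lemma corner_cons n s x (w : 'rV_n) :
  corner s (rv_cons x w) = (0 <= x) && corner (s - x) w.
Proof.
rewrite /corner big_ord_recl rv_cons0//.
under eq_bigr do rewrite rv_consS.
rewrite -lerBrDl andbA; congr (_ && _); apply/forallP/andP => [h|[x0 /forallP h] i].
  by split; [have := h ord0; rewrite rv_cons0|apply/forallP => i; have := h (lift ord0 i); rewrite rv_consS].
by case: (unliftP ord0 i) => [j|] ->; rewrite ?rv_consS ?rv_cons0.
Qed.

Lemma corner_bound n s (w : 'rV_n) i : corner s w -> 0 <= w 0 i <= s.
Proof.
move=> /andP[/forallP w0 ws]; rewrite w0/=; apply: le_trans ws.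
by rewrite (bigD1 i)//= lerDl sumr_ge0.
Qed.

Lemma corner_lt0 n s (w : 'rV_n) : s < 0 -> corner s w = false.
Proof.
move=> s0; apply: contra_ltF s0 => /andP[/forallP w0 ws].
by apply: le_trans ws; exact: sumr_ge0.
Qed.

Lemma Rintegral_rV_eq0 n (f : 'rV[R]_n -> R) : (forall w, f w = 0) -> Rintegral_rV f = 0.
Proof.
elim: n f => [|n IHn] f f0 /=; first exact: f0.
by apply: Rintegral_eq0 => x; apply: IHn => w; exact: f0.
Qed.

(** A negative first coordinate is excluded outright, and one beyond [s] leaves a corner of negative
    size, which is empty. *)
Lemma Rintegral_corner n (phi : 'rV[R]_n.+1 -> R) s :
  Rintegral_rV (fun w => (corner s w)%:R * phi w) =
  \int[mu]_(x in seg 0 s) Rintegral_rV (fun w => (corner (s - x) w)%:R * phi (rv_cons x w)).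
Proof.
rewrite [RHS]Rintegral_mkcond; apply: eq_Rintegral => x _; rewrite patchE.
case: ifPn => [|xs].
  rewrite inE /seg/= in_itv/= => /andP[x0 xs]; congr Rintegral_rV; apply/funext => w.
  by rewrite -/(rv_cons x w) corner_cons x0.
apply: Rintegral_rV_eq0 => w; rewrite -/(rv_cons x w) corner_cons.
case: (leP 0 x) => x0; last by rewrite mul0r.
rewrite corner_lt0 ?mul0r// subr_lt0 ltNge; apply: contra xs => xs.
by rewrite inE /seg/= in_itv/= x0.
Qed.

(** The weights [w] go to the values [b] and the rest of the mass [s] to [a0]. For [s = 1] these are
    barycentric coordinates and the value is the pairing with [y]; a general [s] makes the form
    stable under slicing. *)
Definition phase n (a0 : R) (b : 'I_n -> R) (s : R) (w : 'rV[R]_n) : R :=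
  a0 * (s - \sum_i w 0 i) + \sum_i b i * w 0 i.

Lemma phase_cons n a0 (b : 'I_n.+1 -> R) s x (w : 'rV_n) :
  phase a0 b s (rv_cons x w) = b ord0 * x + phase a0 (fun i => b (lift ord0 i)) (s - x) w.
Proof.
rewrite /phase !big_ord_recl rv_cons0//.
under eq_bigr do rewrite rv_consS.
under [in X in _ + (_ + X) = _]eq_bigr do rewrite rv_consS.
ring.
Qed.

(** Negation exchanges the positive and negative parts, and [fine] sends infinite values to 0 on
    both sides. An arbitrary [h] is therefore covered. *)
Lemma RintegralN (D : set R) (h : R -> R) :
  \int[mu]_(x in D) (- h x) = - \int[mu]_(x in D) h x.
Proof.
have -> : \int[mu]_(x in D) (- h x) = fine (\int[mu]_(x in D) (\- (EFin \o h)) x)%E by [].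
have -> : \int[mu]_(x in D) (h x) = fine (\int[mu]_(x in D) (EFin \o h) x)%E by [].
rewrite (integralE mu D (\- (EFin \o h))%E) (integralE mu D (EFin \o h)).
rewrite funeposN funenegN.
set A := (\int[mu]_(x in D) (EFin \o h)^\-%E x)%E; set B := (\int[mu]_(x in D) (EFin \o h)^\+%E x)%E.
have : (0 <= A)%E by apply: integral_ge0 => x _; exact: funeneg_ge0.
have : (0 <= B)%E by apply: integral_ge0 => x _; exact: funepos_ge0.
by case: A => [a| |]; case: B => [b| |] //= _ _; rewrite ?oppr0 ?opprB.
Qed.

(** The offset [p] gathers the phase of the coordinates already peeled off, so that the slices are
    again of this form. *)
Definition corner_fourier n (k a0 : R) (b : 'I_n -> R) (s p : R) : R[i] :=
  Complex (Rintegral_rV (fun w => (corner s w)%:R * cos (k * (p + phase a0 b s w))))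
    (- Rintegral_rV (fun w => (corner s w)%:R * sin (k * (p + phase a0 b s w)))).

Lemma ek_real (k p : R) : ek k p%:C = Complex (cos (k * p)) (- sin (k * p)).
Proof.
rewrite /ek (_ : - _ * _ = Complex 0 (- (k * p))).
  by rewrite /= expR0 !mul1r cosN sinN.
by apply: complexP => /=; ring.
Qed.

Lemma corner_fourier_cons n k a0 (b : 'I_n.+1 -> R) s p :
  corner_fourier k a0 b s p = cint (seg 0 s) (fun x =>
    corner_fourier k a0 (fun i => b (lift ord0 i)) (s - x) (p + b ord0 * x)).
Proof.
have E x (w : 'rV_n) : k * (p + phase a0 b s (rv_cons x w)) =
    k * (p + b ord0 * x + phase a0 (fun i => b (lift ord0 i)) (s - x) w).
  by rewrite phase_cons addrA.
rewrite /corner_fourier /cint !Rintegral_corner -RintegralN; congr Complex.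
  by apply: eq_Rintegral => x _; congr Rintegral_rV; apply/funext => w; rewrite E.
apply: eq_Rintegral => x _; congr (- Rintegral_rV _).
by apply/funext => w; rewrite E.
Qed.

Lemma map_enum_ordS n (a0 : R) (b : 'I_n.+1 -> R) :
  [seq b i | i <- enum 'I_n.+1] = b ord0 :: [seq b (lift ord0 i) | i <- enum 'I_n].
Proof. by rewrite enum_ordSl /= -map_comp. Qed.

(** Each coordinate peeled off adds one pole and one factor -1/c. In dimension 0 only the vertex
    with value [a0] remains: its single pole ends the list and its 2 pi i accounts for the inverse
    in the constant. *)
Lemma corner_fourierE n (r k a0 : R) (b : 'I_n -> R) s p : 0 < r -> k != 0 -> 0 <= s ->
  `|a0| < r -> (forall i, `|b i| < r) ->
  corner_fourier k a0 b s p = ek k p%:C * ((- (k%:C * ci)^-1) ^+ n * (2 * pi%:C * ci)^-1) *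
    exp_integral r k (rcons [seq b i | i <- enum 'I_n] a0) s.
Proof.
move=> r0 k0 + ar; elim: n b s p => [|n IHn] b s p s0 br.
  have -> : enum 'I_0 = [::] by apply: size0nil; rewrite size_enum_ord.
  rewrite exp_integral_seq1//= expr0 mul1r.
  have p0 : 2 * pi%:C * ci != 0 :> R[i].
    rewrite !mulf_neq0 ?ci_neq0 ?pnatr_eq0//.
    by apply/eqP => /complexI/eqP; rewrite gt_eqF// pi_gt0.
  rewrite -mulrA mulKf// -ekD -rmorphM -rmorphD ek_real /corner_fourier /=.
  rewrite /corner !big_ord0 s0 /phase !big_ord0.
  have -> : [forall i : 'I_0, 0 <= (0 : 'rV[R]_0) 0 i] by apply/forallP => -[].
  by rewrite !mul1r subr0 addr0 (mulrC a0).
have al : all (fun a => `|a| < r) (rcons [seq b (lift ord0 i) | i <- enum 'I_n] a0).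
  by rewrite all_rcons ar/= all_map; apply/allP => i _ /=; exact: br.
rewrite corner_fourier_cons (map_enum_ordS a0) rcons_cons.
set C := (- (k%:C * ci)^-1) ^+ n * (2 * pi%:C * ci)^-1.
(* The exponential of the new offset [p + b ord0 * x] splits into a constant and the factor in [x]
   that [cint_exp_integral] expects. *)
rewrite (@eq_cint _ _ _ (fun x => ek k p%:C * C * ek k ((b ord0)%:C * x%:C) *
    exp_integral r k (rcons [seq b (lift ord0 i) | i <- enum 'I_n] a0) (s - x))); last first.
  move=> x; rewrite /seg/= in_itv/= => /andP[x0 xs].
  rewrite IHn ?subr_ge0// rmorphD rmorphM ekD /C; ring.
rewrite cint_exp_integral//; last by rewrite -size_eq0 size_rcons.
by rewrite /C exprS; ring.
Qed.

Lemma corner_volume n (s : R) : 0 <= s ->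
  Rintegral_rV (fun w : 'rV[R]_n => (corner s w)%:R) = s ^+ n / n`!%:R.
Proof.
elim: n s => [|n IHn] s s0.
  rewrite /= /corner big_ord0 s0 expr0 fact0 divr1 andbT.
  by have -> : [forall i : 'I_0, 0 <= (0 : 'rV[R]_0) 0 i] by apply/forallP => -[].
under eq_fun do rewrite -[_%:R]mulr1.
rewrite (Rintegral_corner (fun=> 1)).
have H (x : R) : is_derive x 1 (fun x => - ((s - x) ^+ n.+1 / n.+1`!%:R)) ((s - x) ^+ n / n`!%:R).
  have dh : is_derive x 1 (fun y : R => s - y) (- 1).
    by have := is_deriveB (is_derive_cst s x 1) (is_derive_id x 1); rewrite sub0r.
  have := is_deriveZ (- (n.+1`!%:R)^-1) (is_deriveX n.+1 dh); rewrite exprfctE.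
  rewrite (_ : _ \*: _ = fun x => - ((s - x) ^+ n.+1 / n.+1`!%:R)); last first.
    by apply/funext => y; rewrite -[LHS]/(- (n.+1`!%:R)^-1 * (s - y) ^+ n.+1) mulNr mulrC.
  rewrite (_ : _ *: _ = (s - x) ^+ n / n`!%:R)//.
  rewrite /GRing.scale/= factS natrM.
  have n0 : n.+1%:R != 0 :> R by rewrite pnatr_eq0.
  have f0 : n`!%:R != 0 :> R by rewrite pnatr_eq0 -lt0n fact_gt0.
  by move: (n.+1%:R : R) (n`!%:R : R) n0 f0 => a c a0 c0; rewrite /=; field; rewrite a0 c0.
transitivity (\int[mu]_(x in seg 0 s) ((s - x) ^+ n / n`!%:R)).
  apply: eq_Rintegral => x; rewrite inE /seg/= in_itv/= => /andP[x0 xs].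
  under eq_fun do rewrite mulr1.
  by rewrite IHn// subr_ge0.
rewrite (Rintegral_FTC s0 H).
  by rewrite subrr expr0n/= mul0r subr0 oppr0 add0r opprK.
move=> x; apply/differentiable_continuous/derivable1_diffP.
have dh : is_derive x 1 (fun y : R => s - y) (- 1).
  by have := is_deriveB (is_derive_cst s x 1) (is_derive_id x 1); rewrite sub0r.
have := is_deriveZ ((n`!%:R)^-1) (is_deriveX n dh); rewrite exprfctE.
rewrite (_ : _ \*: _ = fun x => (s - x) ^+ n / n`!%:R); first by case.
by apply/funext => y; rewrite -[LHS]/((n`!%:R)^-1 * (s - y) ^+ n) mulrC.
Qed.

End StandardSimplex.

(** * From an arbitrary simplex to the corner *)

Section Simplex.
Context {R : realType}.
Notation ci := (@ci R).

Lemma rvmeas_corner n s : rvmeas (fun w : 'rV[R]_n => (corner s w)%:R : R).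
Proof.
move=> d T h mh.
have mI (f g : T -> R) : measurable_fun setT f -> measurable_fun setT g ->
    measurable_fun setT (fun t => (f t <= g t)%R%:R : R).
  move=> mf mg.
  rewrite (_ : (fun _ => _) = fun t => if f t <= g t then 1 else 0 : R).
    by apply: measurable_fun_if => //; exact: measurable_fun_ler.
  by apply/funext => t; case: ifP.
rewrite (_ : _ \o _ = fun t => (\prod_(i <- enum 'I_n) (0 <= h t 0 i)%R%:R) *
    (\sum_i h t 0 i <= s)%R%:R).
  apply: measurable_funM.
    apply: (measurable_prod (h := fun i t => (0 <= h t 0 i)%R%:R)) => i _.
    by apply: mI => //; exact: mh.
  by apply: mI => //; apply: measurable_sum => i; exact: mh.
apply/funext => t /=; rewrite /corner -mulnb natrM; congr (_ * _).
case: forallP => [h0|/forallP/forallPn/= [i hi]].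
  by rewrite big1// => i _; rewrite h0.
by rewrite big_enum/= (bigD1 i)//= (negbTE hi) mul0r.
Qed.

Lemma rv_cbm_corner n s (g : 'rV[R]_n -> R) : 0 <= s -> rvmeas g ->
  (forall w, `|g w| <= 1) -> rv_cbm (fun w => (corner s w)%:R * g w).
Proof.
move=> s0 mg g1; split.
  move=> d T h mh; apply: measurable_funM; first exact: rvmeas_corner mh.
  exact: mg mh.
exists 1, s; split=> // w; split.
  by case: (corner s w); rewrite ?mul1r ?mul0r ?normr0.
case: (boolP (corner s w)) => [sw _ i|_]; last by rewrite mul0r eqxx.
by have /andP[w0 ws] := corner_bound i sw; rewrite ger0_norm.
Qed.

Lemma rvmeas_phase n (phi : R -> R) a0 (b : 'I_n -> R) s :
  measurable_fun setT phi -> rvmeas (fun w : 'rV[R]_n => phi (phase a0 b s w)).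
Proof.
move=> mphi d T h mh; apply: (measurableT_comp mphi (g := fun t => phase a0 b s (h t))).
apply: measurable_funD; last first.
  by apply: measurable_sum => i; apply: measurable_funM => //; exact: mh.
apply: measurable_funM => //; apply: measurable_funB => //.
by apply: measurable_sum => i; exact: mh.
Qed.

Variables (d : nat) (v : 'I_d.+1 -> 'rV[R]_d).
Hypothesis vP : affinely_independent v.
Let M : 'M[R]_d := \matrix_(i < d) (v (lift ord0 i) - v ord0).

Lemma mulmx_edges (w : 'rV[R]_d) :
  w *m M = \sum_i w 0 i *: (v (lift ord0 i) - v ord0).
Proof. by rewrite mulmx_sum_row; apply: eq_bigr => i _; rewrite rowK. Qed.

(** Barycentric coordinates: [w] weights the vertices other than [v ord0], which takes the rest of
    the mass 1. Affine independence makes the weights unique, whence the forward direction. *)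
Lemma simplexP (w : 'rV[R]_d) : simplex v (v ord0 + w *m M) <-> corner 1 w.
Proof.
have comb (l : 'I_d.+1 -> R) : \sum_j l j = 1 ->
    \sum_j l j *: v j = v ord0 + (\row_i l (lift ord0 i)) *m M.
  move=> l1; rewrite mulmx_edges.
  under [in RHS]eq_bigr do rewrite mxE scalerBr.
  rewrite sumrB -scaler_suml big_ord_recl.
  move: l1; rewrite big_ord_recl => l1.
  have -> : l ord0 = 1 - \sum_(i < d) l (lift ord0 i) by rewrite -l1 addrK.
  by rewrite scalerBl scale1r -addrA [in LHS](addrC (- _)).
split=> [[l [l0 [l1]]]|/andP[/forallP w0 w1]].
  rewrite comb// => /addrI /(can_inj (mulmxK vP)) ->; apply/andP; split.
    by apply/forallP => i; rewrite mxE.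
  under eq_bigr do rewrite mxE.
  by rewrite -l1 big_ord_recl lerDr.
pose l j := if unlift ord0 j is Some i then w 0 i else 1 - \sum_i w 0 i.
have lS i : l (lift ord0 i) = w 0 i by rewrite /l liftK.
have l0 : l ord0 = 1 - \sum_i w 0 i by rewrite /l unlift_none.
have l1 : \sum_j l j = 1.
  by rewrite big_ord_recl l0; under [X in _ + X]eq_bigr do rewrite lS; rewrite subrK.
exists l; split.
  move=> j; case: (unliftP ord0 j) => [i|] ->; first by rewrite lS w0.
  by rewrite l0 subr_ge0.
split=> //; rewrite comb//; congr (_ + _ *m _).
by apply/rowP => i; rewrite mxE lS.
Qed.

Lemma dotp_simplex (w y : 'rV[R]_d) :
  dotp (v ord0 + w *m M) y =
  phase (dotp (v ord0) y) (fun i => dotp (v (lift ord0 i)) y) 1 w.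
Proof.
have dD (a b : 'rV[R]_d) : dotp (a + b) y = dotp a y + dotp b y.
  by rewrite /dotp -big_split /=; apply: eq_bigr => i _; rewrite mxE mulrDl.
have dZ c (a : 'rV[R]_d) : dotp (c *: a) y = c * dotp a y.
  by rewrite /dotp mulr_sumr; apply: eq_bigr => i _; rewrite mxE mulrA.
have d0 : dotp 0 y = 0 by rewrite -(scale0r 0) dZ mul0r.
rewrite dD mulmx_edges (big_morph (fun a => dotp a y) dD d0).
rewrite /phase mulrBr mulr1 -addrA; congr (_ + _).
rewrite mulr_sumr -sumrN -big_split; apply: eq_bigr => i _ /=.
by rewrite dZ dD -scaleN1r dZ; ring.
Qed.

(** A general [phi] lets one substitution serve the volume, with [phi] constant 1, and both
    trigonometric integrals. The [rv_cbm] half is what [eintegral_rV_cbm] asks for in the case of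
    the volume. *)
Lemma Rintegral_rV_simplex (t : R) (y : 'rV[R]_d) (phi : R -> R) : 0 < t ->
  measurable_fun setT phi -> (forall x, `|phi x| <= 1) ->
  rv_cbm (fun x => \1_(dilate t (simplex v)) x * phi (dotp x y)) /\
  Rintegral_rV (fun x => \1_(dilate t (simplex v)) x * phi (dotp x y)) =
  t ^+ d * `|\det M| * Rintegral_rV (fun w => (corner 1 w)%:R *
    phi (t * phase (dotp (v ord0) y) (fun i => dotp (v (lift ord0 i)) y) 1 w)).
Proof.
move=> t0 mphi phi1; set ph := phase _ _ _.
pose g (w : 'rV[R]_d) : R := (corner 1 w)%:R * phi (t * ph w).
have gg : rv_cbm g.
  apply: rv_cbm_corner => //.
  apply: (@rvmeas_phase _ (fun u => phi (t * u))).
  by apply: (measurableT_comp mphi); exact: measurable_funM.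
have uM : M \in unitmx by exact: vP.
(* [A] and [b] invert the parametrisation [x = t *: (v ord0 + w *m M)]; the factor t^d |det M| is
   the inverse of |det A|. *)
pose A := t^-1 *: invmx M.
have uA : A \in unitmx by rewrite unitmxZ ?unitmx_inv// unitfE invr_eq0 gt_eqF.
pose b := - (v ord0 *m invmx M).
have E : (fun x => \1_(dilate t (simplex v)) x * phi (dotp x y)) = (fun x => g (x *m A + b)).
  apply/funext => x; set w := x *m A + b.
  have xE : x = t *: (v ord0 + w *m M).
    rewrite /w /A /b mulmxDl mulNmx -scalemxAr -scalemxAl !mulmxKV// addrCA subrr addr0.
    by rewrite scalerA divff ?scale1r// gt_eqF.
  rewrite /g; congr (_ * phi _); last first.
    rewrite /ph -dotp_simplex xE /dotp mulr_sumr.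
    by apply: eq_bigr => i _; rewrite -xE {1}xE mxE mulrA.
  rewrite indicE; congr (nat_of_bool _)%:R; apply/idP/idP.
    rewrite inE => -[u uS ux]; apply/simplexP.
    suff -> : v ord0 + w *m M = u by [].
    apply: (scalerI (_ : t != 0)); first by rewrite gt_eqF.
    by rewrite -xE.
  by move=> /simplexP wS; rewrite inE; exists (v ord0 + w *m M).
rewrite E; split; first exact: rv_cbm_affine.
have := change_of_variables_unitmx uA b gg.
move=> <-; rewrite detZ det_inv normrM normrX !normfV (gtr0_norm t0).
have D0 : `|\det M| != 0 by rewrite normr_eq0 -unitfE.
have td : t ^+ d != 0 by rewrite expf_neq0// gt_eqF.
by rewrite exprVn mulrA mulrACA divff// divff// mulr1 mul1r.
Qed.

End Simplex.

Theorem theorem3 (R : realType) (d : nat) (v : 'I_d.+1 -> 'rV[R]_d)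
    (t : R) (y : 'rV[R]_d) (r : R) :
  (0 < d)%N -> affinely_independent v -> 0 < t ->
  (forall j, `|dotp (v j) y| < r) ->
  fourier_chi (dilate t (simplex v)) y =
    ((-1) ^+ d * (d`!)%:R / (2 * pi%:C * (@ci R)) ^+ d.+1)
    * (fine (lebesgue_rV (simplex v)))%:C
    * circle_integral
        (fun z => cexp (- (2 * pi * t)%:C * (@ci R) * z)
                  / \prod_(j < d.+1) (z - (dotp (v j) y)%:C)) r.
Proof.
move=> _ vP t0 vr.
have r0 : 0 < r by exact: le_lt_trans (vr ord0).
pose k : R := 2 * pi * t.
have p0 : pi != 0 :> R by rewrite gt_eqF// pi_gt0.
have tn0 : t != 0 by rewrite gt_eqF.
have k0 : k != 0 by rewrite /k !mulf_neq0 ?pnatr_eq0.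
set M : 'M[R]_d := \matrix_(i < d) (v (lift ord0 i) - v ord0).
pose a0 := dotp (v ord0) y; pose b i := dotp (v (lift ord0 i)) y.
have vol : fine (lebesgue_rV (simplex v)) = `|\det M| / d`!%:R.
  have [] := Rintegral_rV_simplex vP y ltr01 (phi := fun=> 1) (measurable_cst _).
    by move=> x; rewrite normr1.
  have -> : dilate 1 (simplex v) = simplex v.
    apply/seteqP; split=> [_ [x xS <-]|x xS]; first by rewrite scale1r.
    by exists x => //; rewrite scale1r.
  have -> : (fun x => \1_(simplex v) x * 1) = (\1_(simplex v) : _ -> R).
    by apply/funext => x; rewrite mulr1.
  move=> /eintegral_rV_cbm + E; rewrite /lebesgue_rV => ->; rewrite /= E.
  rewrite (_ : (fun _ => _) = fun w : 'rV[R]_d => (corner 1 w)%:R); last by apply/funext => w; rewrite mulr1.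
  by rewrite corner_volume// !expr1n !mul1r.
have trig (phi : R -> R) : continuous phi -> (forall x, `|phi x| <= 1) ->
    Rintegral_rV (fun x => \1_(dilate t (simplex v)) x * phi (2 * pi * dotp x y)) =
    t ^+ d * `|\det M| *
    Rintegral_rV (fun w => (corner 1 w)%:R * phi (k * (0 + phase a0 b 1 w))).
  move=> cphi phi1.
  have [|//|_ ->] := Rintegral_rV_simplex vP y t0 (phi := fun u => phi (2 * pi * u)).
    apply: (measurableT_comp (continuous_measurable_fun cphi)).
    exact: measurable_funM.
  by congr (_ * Rintegral_rV _); apply/funext => w; rewrite add0r mulrA.
have -> : fourier_chi (dilate t (simplex v)) y =
    (t ^+ d * `|\det M|)%:C * corner_fourier k a0 b 1 0.
  rewrite /fourier_chi (trig cos)//; first last.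
  - by move=> x; rewrite ler_norml cos_geN1 cos_le1.
  - exact: continuous_cos.
  rewrite (trig sin)//; first last.
  - by move=> x; rewrite ler_norml sin_geN1 sin_le1.
  - exact: continuous_sin.
  by apply: complexP; rewrite ?reM ?imM /=; ring.
rewrite (corner_fourierE (b := b) 0 r0 k0 ler01 (vr ord0) (fun i => vr (lift ord0 i))).
(* The vertex [v ord0] comes first in the product of the statement but last in the list of poles. *)
have -> : circle_integral (fun z => cexp (- (2 * pi * t)%:C * (@ci R) * z)
    / \prod_(j < d.+1) (z - (dotp (v j) y)%:C)) r =
    exp_integral r k (rcons [seq b i | i <- enum 'I_d] a0) 1.
  rewrite circle_integralE /oint /exp_integral; apply: eq_cint => th _; congr (_ * _).
  rewrite mul1r /ek mulNr; congr (_ * _); rewrite /polepart expr0 invr1 mul1r.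
  rewrite -prodfV big_ord_recl big_rcons/= big_map big_enum/= mulrC.
  by [].
rewrite /ek mulr0 cexp0 mul1r vol mulrA; congr (_ * exp_integral _ _ _ _).
pose P : R[i] := 2 * pi%:C * ci R.
have tc : t%:C != 0 :> R[i] by apply/eqP => /complexI/eqP; exact/negP.
have fc : d`!%:R != 0 :> R[i] by rewrite pnatr_eq0 -lt0n fact_gt0.
have P0 : P != 0.
  rewrite !mulf_neq0 ?pnatr_eq0 ?ci_neq0//.
  by apply/eqP => /complexI/eqP; exact/negP.
have -> : k%:C * ci R = t%:C * P by rewrite /k /P !rmorphM rmorph_nat; ring.
have -> : (t ^+ d * `|\det M|)%:C = t%:C ^+ d * `|\det M|%:C :> R[i].
  by rewrite rmorphM rmorphXn.
have -> : (`|\det M| / d`!%:R)%:C = `|\det M|%:C / d`!%:R :> R[i].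
  by rewrite rmorphM fmorphV rmorph_nat.
rewrite -/P [(- _^-1) ^+ _]exprNn exprVn exprMn exprS.
have td : t%:C ^+ d != 0 by rewrite expf_neq0.
have Pd : P ^+ d != 0 by rewrite expf_neq0.
by field; rewrite fc P0 td Pd.
Qed.
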